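(* Suppose that $H:\mathbb{R}^2\to\mathbb{R}$, $(x,p)\mapsto H(x,p)$, is uniformly concave in $x$ and uniformly convex in $p$, separable, with Lipschitz continuous derivatives, and that $u_T:\mathbb{R}\to\mathbb{R}$ is convex with Lipschitz continuous derivative. Let $(\mathbf{X},\mathbf{P})$ and $\varpi^N$ solve the $N$-player price formation problem with common noise (as defined in the context), and let $(\tilde{\mathbf{X}},\tilde{\mathbf{P}})$ and $\tilde{\varpi}^N$ be an approximate solution to the $N$-player problem up to the error terms $\epsilon_H$ and $\epsilon_B$ (as defined in the context). Then there exists $C>0$, depending only on the problem data, such that $$\|\varpi^N-\tilde{\varpi}^N\|\le C\big(\|\epsilon_H\|+\|\epsilon_B\|\big).$$
   Context: **Setting.** Let $T>0$ and let $(\Omega,\mathcal{F},\mathbb{F},\mathbb{P})$ be a complete filtered probability space supporting a one-dimensional Brownian motion $W$ (the common noise). All stochastic processes are required to be progressively measurable with respect to this filtration. The supply $Q$ is the real-valued process solving $dQ(t)=b^S(Q(t),t)\,dt+\sigma^S(Q(t),t)\,dW(t)$, $Q(0)=q_0\in\mathbb{R}$, where $b^S,\sigma^S$ satisfy the usual Lipschitz conditions for existence and uniqueness of solutions. Fix an integer $N\ge 1$ and initial positions $x_0^1,\dots,x_0^N\in\mathbb{R}$ (sampled independently from a probability measure $m_0$ on $\mathbb{R}$; the same initial positions are used in both systems below). $H$ is the Legendre transform of a Lagrangian $L$, uniformly convex in $v$: $H(x,p)=\sup_{v\in\mathbb{R}}\{-pv-L(x,v)\}$. ''Separable'' means $H(x,p)=H_1(x)+H_2(p)$.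 Subscripts $x,p$ denote partial derivatives. **$N$-player price formation problem.** $(\mathbf{X},\mathbf{P})$ and $\varpi^N$ (with $\mathbf{X}=(X^1,\dots,X^N)$, $\mathbf{P}=(P^1,\dots,P^N)$, and similarly for other $n$-indexed objects) solve the $N$-player price formation problem with common noise if there is $\mathbf{Z}=(Z^1,\dots,Z^N)$ such that, for $1\le n\le N$ and $t\in[0,T]$, $$\begin{cases} dP^n(t)=H_x(X^n(t),P^n(t)+\varpi^N(t))\,dt+Z^n(t)\,dW(t),\\ P^n(T)=u_T'(X^n(T)),\\ dX^n(t)=-H_p(X^n(t),P^n(t)+\varpi^N(t))\,dt,\\ X^n(0)=x_0^n,\end{cases}$$ together with the market-clearing condition $\frac1N\sum_{n=1}^N -H_p(X^n(t),P^n(t)+\varpi^N(t))=Q(t)$. (These are the optimality conditions for minimizing $\mathbb{E}\big[\frac1N\sum_n\int_0^T L(X^n,v^n)\,dt+u_T(X^n(T))\big]$ with $dX^n=v^n\,dt$, $X^n(0)=x_0^n$, subject to $\frac1N\sum_n v^n=Q$, where $\varpi^N$ is the Lagrange multiplier of the constraint and $P^n+L_v(X^n,v^n)+\varpi^N=0$.) **Approximate solution.** $(\tilde{\mathbf{X}},\tilde{\mathbf{P}})$ and $\tilde\varpi^N$ are an approximate solution up to the error terms $\epsilon_H=(\epsilon^1,\dots,\epsilon^N,\epsilon_T^1,\dots,\epsilon_T^N)$ and $\epsilon_B$, where $\epsilon^n,\epsilon_B:[0,T]\times\Omega\to\mathbb{R}$ and $\epsilon_T^n:\Omega\to\mathbb{R}$,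 if there is $\tilde{\mathbf{Z}}=(\tilde Z^1,\dots,\tilde Z^N)$ such that, for $1\le n\le N$ and $t\in[0,T]$, $$\begin{cases} d\tilde P^n(t)=\big(H_x(\tilde X^n(t),\tilde P^n(t)+\tilde\varpi^N(t))+\epsilon^n(t)\big)\,dt+\tilde Z^n(t)\,dW(t),\\ \tilde P^n(T)=u_T'(\tilde X^n(T))-\epsilon_T^n,\\ d\tilde X^n(t)=-H_p(\tilde X^n(t),\tilde P^n(t)+\tilde\varpi^N(t))\,dt,\\ \tilde X^n(0)=x_0^n,\\ \frac1N\sum_{n=1}^N -H_p(\tilde X^n(t),\tilde P^n(t)+\tilde\varpi^N(t))=Q(t)+\epsilon_B(t).\end{cases}$$ **Integrability.** All processes $X^n,P^n,Z^n,\varpi^N$, their tilde counterparts, $\epsilon^n$ and $\epsilon_B$ have finite norm $\|\cdot\|$ (defined below), and the random variables $\epsilon_T^n$, $X^n(T)$, $\tilde X^n(T)$ are square-integrable; in particular $\int_0^\cdot Z^n\,dW$ and $\int_0^\cdot\tilde Z^n\,dW$ are martingales. **Norms.** For a real process $f$ on $[0,T]\times\Omega$, $\|f\|=\big(\mathbb{E}\big[\|f\|_{L^2([0,T])}^2\big]\big)^{1/2}$; for a real random variable $\xi$, $\|\xi\|=(\mathbb{E}[\xi^2])^{1/2}$; for a vector, $\|\cdot\|^2$ is the sum of the squared norms of the components, so $\|\epsilon_H\|^2=\sum_{n=1}^N(\|\epsilon^n\|^2+\|\epsilon_T^n\|^2)$. **Constant.** ''Problem data'' means $H$, $u_T$,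 $T$, $N$, $m_0$ and the initial positions, and the supply data $q_0,b^S,\sigma^S$; $C$ does not depend on the approximate solution or on the error terms. *)

(* Defs.v *)
From HB Require Import structures.
From mathcomp Require Import all_boot all_order all_algebra.
From mathcomp Require Import all_classical all_reals all_analysis.

Set Implicit Arguments.
Unset Strict Implicit.
Unset Printing Implicit Defensive.

Import Order.TTheory GRing.Theory Num.Theory.
Import numFieldNormedType.Exports.
Local Open Scope classical_set_scope.
Local Open Scope ring_scope.

Section hamiltonian.
Context {R : realType}.
Implicit Types (f : R -> R) (H L : R -> R -> R).

(* quadratic modulus of convexity [gamma]; for [f] of class C^2 this says
   [f'' >= gamma] *)
Definition uniformly_convex (gamma : R) f := forall x y t : R, 0 <= t <= 1 ->
  f (t * x + (1 - t) * y) <=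
  t * f x + (1 - t) * f y - gamma / 2 * (t * (1 - t)) * (x - y) ^+ 2.

Definition uniformly_convex_snd H :=
  exists2 gamma : R, 0 < gamma & forall x, uniformly_convex gamma (H x).

Definition uniformly_concave_fst H :=
  exists2 gamma : R, 0 < gamma &
    forall p, uniformly_convex gamma (fun x => - H x p).

Definition is_legendre_transform H L := forall x p,
  (H x p)%:E = ereal_sup [set (- p * v - L x v)%:E | v in [set: R]].

Definition separable H :=
  exists H1 H2 : R -> R, forall x p, H x p = H1 x + H2 p.

Definition partial_x H (x p : R) : R := derive1 (H ^~ p) x.

Definition partial_p H (x p : R) : R := derive1 (H x) p.

Definition lipschitz_partials H :=
  [/\ forall x p : R, derivable (H ^~ p) x 1,
      forall x p : R, derivable (H x) p 1,
      lipschitz (fun z : R * R => partial_x H z.1 z.2) &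
      lipschitz (fun z : R * R => partial_p H z.1 z.2)].

Definition lipschitz_derivative f :=
  (forall x : R, derivable f x 1) /\ lipschitz (derive1 f).

(* the standard sufficient conditions for strong existence and uniqueness for
   dQ = b(Q,t) dt + sigma(Q,t) dW on [0, T] *)
Definition sde_coefficients (T : R) (b sigma : R -> R -> R) :=
  [/\ measurable_fun ([set: R] `*` `[0, T]) (fun z : R * R => b z.1 z.2),
      measurable_fun ([set: R] `*` `[0, T]) (fun z : R * R => sigma z.1 z.2) &
      exists K : R, forall t : R, 0 <= t <= T ->
        (forall q q', `|b q t - b q' t| + `|sigma q t - sigma q' t|
                      <= K * `|q - q'|) /\
        (forall q, `|b q t| + `|sigma q t| <= K * (1 + `|q|))].

End hamiltonian.

Section stochastic_calculus.
Context {R : realType} {d : measure_display} {Omega : measurableType d}.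
Variables (P : probability Omega R) (T : R) (F : R -> set (set Omega)).
(* A process is a total function of time; only its values on [0, T] matter. *)
Implicit Types (f X b Z M W : R -> Omega -> R) (xi : Omega -> R).

Local Notation mu := (@lebesgue_measure R).

Definition complete_filtration :=
  [/\ forall t : R, 0 <= t <= T -> sigma_algebra [set: Omega] (F t),
      forall t : R, 0 <= t <= T -> F t `<=` measurable,
      forall s t : R, 0 <= s -> s <= t -> t <= T -> F s `<=` F t,
      measure_is_complete P &
      P.-negligible `<=` F 0].

Definition measurable_at (t : R) xi :=
  measurable_fun [set: g_sigma_algebraType (F t)]
    (xi : g_sigma_algebraType (F t) -> R).

Definition progressive f := forall t : R, 0 <= t <= T ->
  measurable_fun (`[0, t] `*` [set: g_sigma_algebraType (F t)])
    (fun z : R * g_sigma_algebraType (F t) => f z.1 z.2).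

Definition continuous_paths f :=
  {ae P, forall w, {within `[0, T], continuous (f ^~ w)}}.

Definition process_norm f : \bar R :=
  sqrte (\int[P]_w \int[mu]_(t in `[0%R, T]) ((f t w) ^+ 2)%:E)%E.

Definition rv_norm xi : \bar R := sqrte (\int[P]_w ((xi w) ^+ 2)%:E)%E.

Definition is_brownian_motion W :=
  [/\ progressive W,
      {ae P, forall w, W 0 w = 0},
      continuous_paths W,
      forall (s t : R) (A : set R), 0 <= s -> s < t -> t <= T -> measurable A ->
        P ((W t \- W s) @^-1` A)
        = normal_prob 0 (Num.sqrt (t - s)) A &
      forall (s t : R) (A : set R) (E : set Omega),
        0 <= s -> s < t -> t <= T -> measurable A -> F s E ->
        P (E `&` (W t \- W s) @^-1` A)
        = (P E * P ((W t \- W s)%R @^-1` A))%E].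

(* [sp_coef i] is the value on the time interval ]sp_time i, sp_time i.+1],
   for [i < sp_size]; the process vanishes elsewhere *)
Record simple_process := SimpleProcess {
  sp_size : nat;
  sp_time : nat -> R;
  sp_coef : nat -> Omega -> R }.

Definition is_simple_predictable (phi : simple_process) :=
  [/\ 0 <= sp_time phi 0,
      sp_time phi (sp_size phi) <= T,
      forall i, (i < sp_size phi)%N -> sp_time phi i <= sp_time phi i.+1,
      forall i, (i < sp_size phi)%N ->
        measurable_at (sp_time phi i) (sp_coef phi i) &
      forall i, (i < sp_size phi)%N ->
        exists K : R, forall w, `|sp_coef phi i w| <= K].

Definition simple_value (phi : simple_process) (t : R) (w : Omega) : R :=
  \sum_(i < sp_size phi)
    sp_coef phi i w * \1_(`]sp_time phi i, sp_time phi i.+1]) t.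

Definition simple_integral W (phi : simple_process) (t : R) (w : Omega) : R :=
  \sum_(i < sp_size phi)
    sp_coef phi i w * (W (Num.min (sp_time phi i.+1) t) w
                       - W (Num.min (sp_time phi i) t) w).

(* [M] is (a continuous version of) the process [\int_0^. Z dW], for a square
   integrable [Z]: the limit of the integrals of simple processes that
   approximate [Z] in L^2([0, T] * Omega) *)
Definition is_ito_integral W Z M :=
  [/\ progressive M,
      continuous_paths M &
      exists phi : nat -> simple_process,
        [/\ forall k, is_simple_predictable (phi k),
            process_norm (fun t w => simple_value (phi k) t w - Z t w)
              @[k --> \oo] --> 0%E &
            forall t : R, 0 <= t <= T ->
              rv_norm (fun w => simple_integral W (phi k) t w - M t w)
                @[k --> \oo] --> 0%E]].

(* dX = b dt on [0, T] *)
Definition time_differential X b :=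
  {ae P, forall w, mu.-integrable `[0, T] (EFin \o b ^~ w)} /\
  {ae P, forall w, forall t : R, 0 <= t <= T ->
    X t w = X 0 w + \int[mu]_(s in `[0, t]) b s w}.

(* dX = b dt + Z dW on [0, T] *)
Definition ito_differential W X b Z :=
  {ae P, forall w, mu.-integrable `[0, T] (EFin \o b ^~ w)} /\
  exists2 M, is_ito_integral W Z M &
    {ae P, forall w, forall t : R, 0 <= t <= T ->
      X t w = X 0 w + \int[mu]_(s in `[0, t]) b s w + M t w}.

Definition square_integrable_process f :=
  progressive f /\ (process_norm f < +oo)%E.

Definition square_integrable_rv xi :=
  measurable_fun [set: Omega] xi /\ (rv_norm xi < +oo)%E.

Definition solves_supply_sde W (q0 : R) (bS sigmaS : R -> R -> R) Q :=
  [/\ progressive Q,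
      {ae P, forall w, Q 0 w = q0} &
      ito_differential W Q (fun t w => bS (Q t w) t)
                           (fun t w => sigmaS (Q t w) t)].

End stochastic_calculus.

Section price_formation.
Context {R : realType} {d : measure_display} {Omega : measurableType d}.
Variables (P : probability Omega R) (T : R) (F : R -> set (set Omega)).
Variables (W : R -> Omega -> R) (N : nat) (H : R -> R -> R) (uT : R -> R).
Variables (x0 : 'I_N -> R) (Q : R -> Omega -> R).

Local Notation process := (R -> Omega -> R).

(* [Y] is the adjoint (costate) process, so that [P] can denote the probability
   measure *)
Definition solves_price_formation
    (X Y : 'I_N -> process) (varpi : process) :=
  square_integrable_process P T F varpi /\
  exists Z : 'I_N -> process,
  (forall n : 'I_N,
    [/\ square_integrable_process P T F (X n),
        square_integrable_process P T F (Y n),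
        square_integrable_process P T F (Z n) &
        square_integrable_rv P (X n T)]) /\
  (forall n : 'I_N,
    [/\ ito_differential P T F W (Y n)
          (fun t w => partial_x H (X n t w) (Y n t w + varpi t w)) (Z n),
        {ae P, forall w, Y n T w = derive1 uT (X n T w)},
        time_differential P T (X n)
          (fun t w => - partial_p H (X n t w) (Y n t w + varpi t w)) &
        {ae P, forall w, X n 0 w = x0 n}]) /\
  (forall t : R, 0 <= t <= T -> {ae P, forall w,
    N%:R^-1 * (\sum_(n < N) - partial_p H (X n t w) (Y n t w + varpi t w))
    = Q t w}).

Definition approx_solves_price_formation
    (eps : 'I_N -> process) (epsT : 'I_N -> Omega -> R) (epsB : process)
    (X Y : 'I_N -> process) (varpi : process) :=
  square_integrable_process P T F varpi /\
  square_integrable_process P T F epsB /\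
  (forall n : 'I_N, square_integrable_process P T F (eps n) /\
                    square_integrable_rv P (epsT n)) /\
  exists Z : 'I_N -> process,
  (forall n : 'I_N,
    [/\ square_integrable_process P T F (X n),
        square_integrable_process P T F (Y n),
        square_integrable_process P T F (Z n) &
        square_integrable_rv P (X n T)]) /\
  (forall n : 'I_N,
    [/\ ito_differential P T F W (Y n)
          (fun t w => partial_x H (X n t w) (Y n t w + varpi t w) + eps n t w)
          (Z n),
        {ae P, forall w, Y n T w = derive1 uT (X n T w) - epsT n w},
        time_differential P T (X n)
          (fun t w => - partial_p H (X n t w) (Y n t w + varpi t w)) &
        {ae P, forall w, X n 0 w = x0 n}]) /\
  (forall t : R, 0 <= t <= T -> {ae P, forall w,
    N%:R^-1 * (\sum_(n < N) - partial_p H (X n t w) (Y n t w + varpi t w))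
    = Q t w + epsB t w}).

Definition error_norm
    (eps : 'I_N -> process) (epsT : 'I_N -> Omega -> R) : \bar R :=
  sqrte (\sum_(n < N)
    (process_norm P T (eps n) ^+ 2 + rv_norm P (epsT n) ^+ 2))%E.

End price_formation.

(* Main.v *)
Require Import Defs.
From HB Require Import structures.
From mathcomp Require Import all_boot all_order all_algebra.
From mathcomp Require Import all_classical all_reals all_analysis.
From mathcomp Require Import ring lra measurable_realfun.

Set Implicit Arguments.
Unset Strict Implicit.
Unset Printing Implicit Defensive.

Import Order.TTheory GRing.Theory Num.Theory.
Import numFieldNormedType.Exports.
Local Open Scope classical_set_scope.
Local Open Scope ring_scope.

(** The proof is an energy estimate for the difference of the two systems. Write
[x], [y], [v] for the differences of the states, of the costates and of the
prices, [p = y + v], [a = dx/dt] and [b] for the drift of [y].  Separability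
turns the partial derivatives of [H] into functions of one variable, so that
uniform convexity in [p] and concavity in [x] become [a * p <= - gp * p ^+ 2]
and [b * x <= - gx * x ^+ 2 - eps * x].

Duality.  Since [x] is differentiable in time and starts at 0,
[E (x T * y T) = E (int a * y) + E (int b * x)]
([terminal_pairing]).  No Ito formula is needed: [x T = int a], and
[y T - y t] is the sum of the integral of [b] over [t, T] and of an increment
[dm t] of a stochastic integral.  Exchanging the order of integration for every
path ([time_parts]) leaves only the term [E (int a * dm)], which vanishes because
[a] is adapted ([ito_increment_orthogonal]).  That orthogonality comes from the
definition of the integral as a limit of simple integrals, where it reduces to
the independence of Brownian increments from the past ([increment_orthogonal],
[ito_integral_orthogonal]).

Monotonicity.  As [uT'] is monotone, [x T * y T >= x T * epsT].  Inserting the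
monotonicity bounds into the duality identity and writing [y = p - v] gives,
for each player, control of [|p|^2 + |x|^2] by the errors and by
[- E (int a * v)] ([player_monotonicity]).  Summed over the players, market
clearing in both systems turns the last term into [N * E (int epsB * v)]
([market_clearing_pairing]).

Recovering the price.  The price gap is [v = p - y], and the same orthogonality,
now with [y] as the adapted factor, bounds the backward component [y] by its
terminal value and its drift ([adjoint_L2_le]); these are controlled by [x T],
[x] and the errors, and [x T] by [p] because [|a| <= Kp * |p|]
([price_gap_le]).  Hence [|v|^2] is at most a multiple of
[|p|^2 + |x|^2 + errors], and a weighted Young inequality absorbs the
contribution of [v] to the right-hand side ([absorb]). *)

(** * Integrable and square-integrable functions *)

Section square_integrable.
Context d {T : measurableType d} {R : realType} (m : {measure set T -> \bar R}).
Implicit Types f g : T -> R.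

Definition L1 f := m.-integrable setT (EFin \o f).
(** Measurability of [f] is a separate clause: it does not follow from the
integrability of the square. *)
Definition L2 f := measurable_fun setT f /\ L1 (fun x => f x ^+ 2).

Lemma L1_measurable f : L1 f -> measurable_fun setT f.
Proof. by move=> /measurable_int /measurable_EFinP. Qed.

Lemma L1_le f g : measurable_fun setT f -> (forall x, `|f x| <= g x) ->
  L1 g -> L1 f.
Proof.
move=> mf fg; apply: le_integrable => //; first exact/measurable_EFinP.
by move=> x _ /=; rewrite lee_fin (le_trans (fg x))// ler_norm.
Qed.

Lemma L1D f g : L1 f -> L1 g -> L1 (fun x => f x + g x).
Proof. by move=> If Ig; have := integrableD measurableT If Ig. Qed.

Lemma L1B f g : L1 f -> L1 g -> L1 (fun x => f x - g x).
Proof. by move=> If Ig; have := integrableB measurableT If Ig. Qed.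

Lemma L1Z k f : L1 f -> L1 (fun x => k * f x).
Proof. by move=> If; have := integrableZl measurableT k If. Qed.

Lemma L1_sum (I : Type) (s : seq I) (h : I -> T -> R) :
  (forall i, L1 (h i)) -> L1 (fun x => \sum_(i <- s) h i x).
Proof.
move=> hL1; elim: s => [|i s ih].
  by under [X in L1 X]eq_fun do rewrite big_nil; exact: integrable0.
by under [X in L1 X]eq_fun do rewrite big_cons; exact: L1D.
Qed.

Lemma L1_restrict (A : set T) f : measurable A -> L1 f -> L1 (f \_ A).
Proof.
move=> mA If; rewrite /L1 -restrict_EFin.
apply: (iffLR (@integrable_mkcond _ _ _ m A (EFin \o f) mA)).
exact: (integrableS _ _ _ If).
Qed.

Lemma L2_le f g : measurable_fun setT f -> (forall x, `|f x| <= `|g x|) ->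
  L2 g -> L2 f.
Proof.
move=> mf fg [mg ig]; split=> //; apply: (L1_le _ _ ig).
  exact: measurable_funX.
by move=> x; rewrite normrX -[leRHS]real_normK ?num_real// lerXn2r ?nnegrE.
Qed.

Lemma L2D f g : L2 f -> L2 g -> L2 (fun x => f x + g x).
Proof.
move=> [mf If] [mg Ig]; split; first exact: measurable_funD.
apply: (@L1_le _ (fun x => 2 * f x ^+ 2 + 2 * g x ^+ 2)).
- by apply: measurable_funX; exact: measurable_funD.
- by move=> x; rewrite ger0_norm ?sqr_ge0//; have := sqr_ge0 (f x - g x); lra.
- by apply: L1D; exact: L1Z.
Qed.

Lemma L2Z k f : L2 f -> L2 (fun x => k * f x).
Proof.
move=> [mf If]; split; first exact: measurable_funM.
by under [X in L1 X]eq_fun do rewrite exprMn; exact: L1Z.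
Qed.

Lemma L2N f : L2 f -> L2 (fun x => - f x).
Proof.
by move=> /(L2Z (-1)); congr L2; apply/funext => x; rewrite mulN1r.
Qed.

Lemma L2B f g : L2 f -> L2 g -> L2 (fun x => f x - g x).
Proof. by move=> ? /L2N; exact: L2D. Qed.

Lemma L2M f g : L2 f -> L2 g -> L1 (fun x => f x * g x).
Proof.
move=> [mf If] [mg Ig].
apply: (@L1_le _ (fun x => f x ^+ 2 + g x ^+ 2)); last exact: L1D.
  exact: measurable_funM.
move=> x; rewrite ler_norml.
have := sqr_ge0 (f x - g x); have := sqr_ge0 (f x + g x).
by have := sqr_ge0 (f x); have := sqr_ge0 (g x); lra.
Qed.

Lemma L2P f : measurable_fun setT f ->
  (\int[m]_x ((f x) ^+ 2)%:E < +oo)%E -> L2 f.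
Proof.
move=> mf If; split=> //; apply/integrableP; split.
  by apply/measurable_EFinP; exact: measurable_funX.
under eq_integral do rewrite /= ger0_norm ?sqr_ge0//.
exact: If.
Qed.

Lemma L2_sqrE f : L2 f ->
  (\int[m]_x ((f x) ^+ 2)%:E = (\int[m]_x (f x) ^+ 2)%:E)%E.
Proof.
by move=> [_ If]; rewrite /Rintegral fineK//; exact: (integrable_fin_num measurableT).
Qed.

Lemma Rintegral_sum n (h : 'I_n -> T -> R) : (forall i, L1 (h i)) ->
  \int[m]_x \sum_(i < n) h i x = \sum_(i < n) \int[m]_x h i x.
Proof.
elim: n h => [|n ih] h Ih.
  rewrite big_ord0 /Rintegral integral0_eq//= => x _.
  by rewrite big_ord0.
under eq_Rintegral do rewrite big_ord_recr/=.
rewrite RintegralD//; last 2 first.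
- by apply: L1_sum => i; exact: Ih.
- exact: Ih.
by rewrite ih// big_ord_recr.
Qed.

Lemma ae_le_Rintegral f g : L1 f -> L1 g -> {ae m, forall x, f x <= g x} ->
  \int[m]_x f x <= \int[m]_x g x.
Proof.
move=> If Ig fg; rewrite -subr_ge0 -RintegralB//.
have I_gf := L1B Ig If.
have mgf := L1_measurable I_gf.
rewrite /Rintegral (ae_eq_integral (fun x => (`|g x - f x|)%:E))//.
- by apply: fine_ge0; exact: integral_ge0.
- by apply/measurable_EFinP.
- by apply/measurable_EFinP; exact: measurableT_comp.
- by apply: filterS fg => x fgx _; rewrite ger0_norm// subr_ge0.
Qed.

Lemma ae_eq_Rintegral f g : measurable_fun setT f -> measurable_fun setT g ->
  {ae m, forall x, f x = g x} -> \int[m]_x f x = \int[m]_x g x.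
Proof.
move=> mf mg fg; rewrite /Rintegral; congr fine.
apply: ae_eq_integral => //; try exact/measurable_EFinP.
by apply: filterS fg => x /= ->.
Qed.

Lemma ae_le_L1 f g : measurable_fun setT f -> L1 g ->
  {ae m, forall x, `|f x| <= g x} -> L1 f.
Proof.
move=> mf Ig fg; apply/integrableP; split; first exact/measurable_EFinP.
have /integrableP[mEg] := Ig; apply: le_lt_trans.
apply: ae_ge0_le_integral => //.
- by apply: measurableT_comp => //; exact/measurable_EFinP.
- exact: measurableT_comp.
apply: filterS fg => x fgx _ /=; rewrite lee_fin.
by rewrite (le_trans fgx)// ler_norm.
Qed.

End square_integrable.

Section finite_measure.
Context d {T : measurableType d} {R : realType}.
Variables (m : {finite_measure set T -> \bar R}).

Lemma L1_cst (c : R) : L1 m (fun=> c).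
Proof. exact: finite_measure_integrable_cst. Qed.

Lemma L2_L1 (f : T -> R) : L2 m f -> L1 m f.
Proof.
move=> [mf If]; apply: (@L1_le _ _ _ _ _ (fun w => 1 + f w ^+ 2)) => //.
  move=> w; rewrite ler_norml; have := sqr_ge0 (f w + 1).
  by have := sqr_ge0 (f w - 1); have := sqr_ge0 (f w); lra.
by apply: L1D => //; exact: L1_cst.
Qed.

End finite_measure.

(** * Iterated integrals of real-valued functions *)

Section iterated.
Context d1 d2 {S : measurableType d1} {U : measurableType d2} {R : realType}.
Variables (m1 : {sigma_finite_measure set S -> \bar R}).
Variables (m2 : {sigma_finite_measure set U -> \bar R}).
Implicit Types f : S * U -> R.

Lemma L1_sections1 f : L1 (m1 \x m2)%E f ->
  {ae m1, forall x, L1 m2 (fun y => f (x, y))}.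
Proof. exact: ae_integrable1. Qed.

Lemma L1_sections2 f : L1 (m1 \x m2)%E f ->
  {ae m2, forall y, L1 m1 (fun x => f (x, y))}.
Proof. exact: ae_integrable2. Qed.

(** The inner real integral agrees with the extended one only at the points whose
section is integrable, hence almost everywhere. *)
Lemma L1_iterated1 f : L1 (m1 \x m2)%E f ->
  L1 m1 (fun x => \int[m2]_y f (x, y)) /\
  \int[m1]_x \int[m2]_y f (x, y) = \int[(m1 \x m2)%E]_z f z.
Proof.
move=> If; have IF := integrable_fubini_F If.
have mF : measurable_fun setT (fun x => \int[m2]_y f (x, y)).
  by have /measurable_int mF := IF; apply: measurableT_comp.
have aeF : ae_eq m1 setT (EFin \o (fun x => \int[m2]_y f (x, y)))
                         (fubini_F m2 (EFin \o f)).
  apply: filterS (L1_sections1 If) => x Ix _ /=.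
  by rewrite /Rintegral fineK//; exact: (integrable_fin_num measurableT).
split.
  apply/integrableP; split; first exact/measurable_EFinP.
  have /integrableP[mG] := IF; apply: le_lt_trans.
  rewrite (ae_eq_integral (abse \o fubini_F m2 (EFin \o f)))//.
  - by apply: measurableT_comp => //; exact/measurable_EFinP.
  - exact: measurableT_comp.
  - by apply: filterS aeF => x /(_ I) /= + _ => <-.
rewrite {1}/Rintegral (ae_eq_integral _ _ _ _ _ aeF)//.
- by rewrite integral12_prod_meas1.
- exact/measurable_EFinP.
- exact: (measurable_int m1).
Qed.

Lemma L2_sections1 f : L2 (m1 \x m2)%E f ->
  {ae m1, forall x, L2 m2 (fun y => f (x, y))}.
Proof.
move=> [mf If]; apply: filterS (L1_sections1 If) => x Ix; split=> //.
exact: measurableT_comp.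
Qed.

Lemma L2_sections2 f : L2 (m1 \x m2)%E f ->
  {ae m2, forall y, L2 m1 (fun x => f (x, y))}.
Proof.
move=> [mf If]; apply: filterS (L1_sections2 If) => y Iy; split=> //.
exact: measurableT_comp.
Qed.

End iterated.

Section iterated_swap.
Context d1 d2 {S : measurableType d1} {U : measurableType d2} {R : realType}.
Variables (m1 : {sigma_finite_measure set S -> \bar R}).
Variables (m2 : {sigma_finite_measure set U -> \bar R}).

Lemma L1_iterated2 (f : S * U -> R) : L1 (m1 \x m2)%E f ->
  L1 m2 (fun y => \int[m1]_x f (x, y)) /\
  \int[m2]_y \int[m1]_x f (x, y) = \int[(m1 \x m2)%E]_z f z.
Proof.
move=> If; pose g (z : U * S) := f (z.2, z.1).
have Ig : L1 (m2 \x m1)%E g.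
  apply/integrable12ltyP.
    apply/measurable_EFinP; apply: (measurableT_comp (L1_measurable If)).
    exact: measurable_swap.
  have [+ _] := (integrable21ltyP m1 m2 (measurable_int _ If)).
  exact.
have [IG GE] := L1_iterated1 Ig; split=> //.
rewrite GE /Rintegral; congr fine.
rewrite -integral12_prod_meas1// -integral21_prod_meas1//.
Qed.

End iterated_swap.

(** * The mean of a centred normal law *)

Section normal_moments.
Context {R : realType}.
Local Notation mu := (@lebesgue_measure R).

Variables (s : R) (s_neq0 : s != 0).
Local Notation N := (normal_prob 0 s).
Local Notation pdf := (normal_pdf 0 s).

Let pdf_even x : pdf (- x) = pdf x.
Proof. by rewrite !normal_pdfE// /normal_fun !subr0 sqrrN. Qed.

Lemma normal_prob_opp (A : set R) : measurable A ->
  N (-%R @^-1` A) = N A.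
Proof.
move=> mA; have mN : measurable_fun [set: R] (-%R : R -> R).
  exact: oppr_measurable.
transitivity (\int[mu]_(x in (-%R : _ -> measurableTypeR R) @^-1` A)
   ((EFin \o pdf) \o (-%R : _ -> measurableTypeR R)) x)%E.
  by apply: eq_integral => x _; rewrite /= pdf_even.
rewrite -ge0_integral_pushforward//; last 2 first.
- by apply/measurable_EFinP; apply: measurable_funTS; exact: measurable_normal_pdf.
- by move=> y _; rewrite lee_fin normal_pdf_ge0.
by rewrite /normal_prob; apply: eq_measure_integral => B mB _; exact: lebesgue_measureN.
Qed.

Lemma ge0_integral_normal (f : R -> \bar R) : (forall x, 0 <= f x)%E ->
  measurable_fun setT f ->
  (\int[N]_x f x = \int[mu]_x (f x * (pdf x)%:E))%E.
Proof.
move=> f0 mf; have Nmu := normal_prob_dominates (0 : R) s.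
rewrite -(Radon_Nikodym_SigmaFinite.change_of_variables Nmu)//.
apply: ae_eq_integral => //.
- apply: emeasurable_funM => //.
  exact: measurable_int (Radon_Nikodym_SigmaFinite.f_integrable Nmu).
- apply: emeasurable_funM => //; apply/measurable_EFinP.
  exact: measurable_normal_pdf.
apply: ae_eqe_mul2l; apply: integral_ae_eq => //.
- exact: Radon_Nikodym_SigmaFinite.f_integrable.
- by apply/measurable_EFinP; exact: measurable_normal_pdf.
- by move=> E _ mE; rewrite -Radon_Nikodym_SigmaFinite.f_integral.
Qed.

(** With [u = |x| / |s|], the inequality [u <= 1 + u ^+ 2 / 4 <= expR (u ^+ 2 / 4)]
trades the factor [|x|] for half of the exponent: what is left is a multiple of
the normal density of standard deviation [sqrt 2 * s]. *)
Lemma normal_L1_id : L1 N (@id R).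
Proof.
apply/integrableP; split; first exact/measurable_EFinP.
rewrite ge0_integral_normal//; last first.
  by apply: measurableT_comp => //; exact/measurable_EFinP.
pose s' := Num.sqrt 2 * s.
have s'_neq0 : s' != 0 by rewrite mulf_neq0// gt_eqF// sqrtr_gt0.
pose k := `|s| * (normal_peak s / normal_peak s').
have pk : 0 < normal_peak s' by exact: normal_peak_gt0.
have Ik : mu.-integrable setT (EFin \o (fun x => k * normal_pdf 0 s' x)).
  apply: (integrableZl measurableT k (integrable_normal_pdf 0 s')).
have /integrableP[_] := Ik; apply: le_lt_trans; apply: ge0_le_integral => //.
- by move=> x _; rewrite mule_ge0// lee_fin normal_pdf_ge0.
- apply: emeasurable_funM; first by apply: measurableT_comp => //; exact/measurable_EFinP.
  by apply/measurable_EFinP; exact: measurable_normal_pdf.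
- by apply: measurableT_comp => //; exact: measurable_int Ik.
move=> x _ /=; rewrite -EFinM lee_fin; apply: le_trans (ler_norm _).
rewrite !normal_pdfE// /normal_fun subr0.
have -> : k * (normal_peak s' * expR (- x ^+ 2 / (s' ^+ 2 *+ 2))) =
   normal_peak s * (`|s| * expR (- x ^+ 2 / (s' ^+ 2 *+ 2))).
  by rewrite /k; field; rewrite gt_eqF.
rewrite mulrCA ler_wpM2l ?normal_peak_ge0//.
have -> : - x ^+ 2 / (s ^+ 2 *+ 2) =
    - x ^+ 2 / (s' ^+ 2 *+ 2) + - (x ^+ 2 / (s' ^+ 2 *+ 2)).
  rewrite /s' exprMn sqr_sqrtr//; field.
  exact: s_neq0.
rewrite expRD mulrCA [leRHS]mulrC ler_wpM2l ?expR_ge0//.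
rewrite expRN ler_pdivrMr ?expR_gt0//.
have s_gt0 : 0 < `|s| by rewrite normr_gt0.
rewrite -ler_pdivrMl//; apply: le_trans (expR_ge1Dx _).
rewrite /s' exprMn sqr_sqrtr// -(real_normK (num_real x)) -(real_normK (num_real s)).
have -> : `|x| ^+ 2 / ((2 * `|s| ^+ 2) *+ 2) = (`|s|^-1 * `|x| / 2) ^+ 2.
  by field; rewrite gt_eqF.
set u := `|s|^-1 * `|x|.
by have := sqr_ge0 (u / 2 - 1); lra.
Qed.

(** The law is invariant under reflection, so the mean equals its opposite. *)
Lemma normal_mean : \int[N]_x x = 0 :> R.
Proof.
have mN : measurable_fun [set: measurableTypeR R]
    (-%R : _ -> measurableTypeR R) by exact: oppr_measurable.
suff : \int[N]_x x = - \int[N]_x x :> R by lra.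
rewrite -mulN1r -RintegralZl//; last exact: normal_L1_id.
rewrite /Rintegral; congr fine.
rewrite (eq_measure_integral (pushforward N (-%R : _ -> measurableTypeR R))).
  rewrite integral_pushforward//.
  - by apply: eq_integral => x _; rewrite /= mulN1r.
  - have := L1Z (-1) normal_L1_id; congr (_.-integrable _ _).
    by apply/funext => x; rewrite /= mulN1r.
by move=> A mA _; rewrite -[LHS]normal_prob_opp.
Qed.

End normal_moments.

(** * Independence of Brownian increments from the past *)

Section filtration.
Context {R : realType} {d : measure_display} {Omega : measurableType d}.
Variables (P : probability Omega R) (T : R) (F : R -> set (set Omega)).
Hypothesis filtF : complete_filtration P T F.

Lemma filtration_sigma (t : R) : 0 <= t <= T ->
  @measurable _ (g_sigma_algebraType (F t)) = F t.
Proof. by move=> t0T; apply: sigma_algebra_id; case: filtF => /(_ t t0T). Qed.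

Lemma measurable_atP (t : R) (xi : Omega -> R) : 0 <= t <= T ->
  measurable_at F t xi <-> forall B, measurable B -> F t (xi @^-1` B).
Proof.
move=> t0T; have E := filtration_sigma t0T.
split=> [mxi B mB|mxi _ B mB]; last by rewrite setTI E; exact: mxi.
by have := mxi measurableT B mB; rewrite setTI E.
Qed.

Lemma measurable_at_measurable (t : R) (xi : Omega -> R) : 0 <= t <= T ->
  measurable_at F t xi -> measurable_fun setT xi.
Proof.
move=> t0T /(measurable_atP _ t0T) mxi _ B mB; rewrite setTI.
by have [_ + _ _ _] := filtF; apply; [exact: t0T|exact: mxi].
Qed.

Lemma measurable_at_le (s t : R) (xi : Omega -> R) : 0 <= s -> s <= t -> t <= T ->
  measurable_at F s xi -> measurable_at F t xi.
Proof.
move=> s0 st tT; have s0T : 0 <= s <= T by rewrite s0 (le_trans st).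
have t0T : 0 <= t <= T by rewrite tT (le_trans s0).
move=> /(measurable_atP _ s0T) mxi; apply/measurable_atP => // B mB.
have [_ _ Fst _ _] := filtF.
exact: (Fst s t) (mxi _ mB).
Qed.

Lemma progressive_measurable_at f (t : R) : 0 <= t <= T ->
  progressive T F f -> measurable_at F t (f t).
Proof.
move=> t0T /(_ t t0T) mf.
apply: (@measurable_comp _ _ _ _ _ _ (`[0, t] `*` [set: g_sigma_algebraType (F t)])
  (fun z : R * g_sigma_algebraType (F t) => f z.1 z.2) setT (fun w => (t, w))) => //.
- by apply: measurableX.
- by move=> _ [w _ <-] /=; split=> //=; rewrite in_itv/= lexx andbT; case/andP: t0T.
- exact: pair1_measurable.
Qed.

Lemma progressive_measurable f (t : R) : 0 <= t <= T ->
  progressive T F f -> measurable_fun setT (f t).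
Proof.
by move=> t0T pf; apply: (measurable_at_measurable t0T); exact: progressive_measurable_at.
Qed.

End filtration.

Section increments.
Context {R : realType} {d : measure_display} {Omega : measurableType d}.
Variables (P : probability Omega R) (T : R) (F : R -> set (set Omega)).
Variables (W : R -> Omega -> R).
Hypotheses (filtF : complete_filtration P T F).
Hypotheses (W_bm : is_brownian_motion P T F W).

(** Independence says that the law of [(w, W v w - W u w)] on the product of
[(Omega, F u)] with the real line is a product measure.  Fubini then integrates
the increment first, and its mean is zero. *)
Lemma increment_orthogonal (u v : R) (eta : Omega -> R) :
  0 <= u -> u < v -> v <= T -> measurable_at F u eta -> L1 P eta ->
  L1 P (fun w => eta w * (W v w - W u w)) /\
  \int[P]_w (eta w * (W v w - W u w)) = 0.
Proof.
move=> u0 uv vT meta Ieta.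
have u0T : 0 <= u <= T by rewrite u0 (le_trans (ltW uv)).
have v0T : 0 <= v <= T by rewrite vT (le_trans u0 (ltW uv)).
have [pW _ _ lawW indepW] := W_bm.
pose G := g_sigma_algebraType (F u).
pose Delta w := W v w - W u w.
have mDelta : measurable_fun setT Delta.
  apply: measurable_funB; first exact: (progressive_measurable filtF v0T).
  exact: (progressive_measurable filtF u0T).
have mid : measurable_fun [set: Omega] (id : Omega -> G).
  move=> _ B mB; rewrite setTI.
  have [_ + _ _ _] := filtF; apply; first exact: u0T.
  by rewrite -(filtration_sigma filtF).
have mY : measurable_fun [set: Omega] (fun w => (w, Delta w) : G * measurableTypeR R).
  exact: measurable_fun_pair.
pose X : {mfun Omega >-> G} := HB.pack (id : Omega -> G) (isMeasurableFun.Build _ _ _ _ _ mid).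
pose Y : {mfun Omega >-> (G * measurableTypeR R)%type} :=
  HB.pack (fun w => (w, Delta w) : G * measurableTypeR R) (isMeasurableFun.Build _ _ _ _ _ mY).
pose sigma := Num.sqrt (v - u).
have sigma_neq0 : sigma != 0 by rewrite gt_eqF// sqrtr_gt0 subr_gt0.
pose m1 := distribution P X.
pose m2 : probability (measurableTypeR R) R := normal_prob 0 sigma.
(* This is the independence of the increment from [F u], extended from
   rectangles to all measurable sets of the product. *)
have m12 A : measurable A -> distribution P Y A = (m1 \x m2)%E A.
  move=> mA; apply/esym/product_measure_unique => // B C mB mC.
  rewrite /= /distribution/= /pushforward.
  rewrite -(lawW u v)// -(indepW u v C B)//.
  by rewrite -(filtration_sigma filtF).
have meta1 : measurable_fun [set: G * measurableTypeR R] (fun z => eta z.1 * z.2).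
  apply: measurable_funM => //.
  apply: (@measurableT_comp _ _ _ _ _ _ (eta : G -> R)) => //.
have Ieta1 : L1 m1 (eta : G -> R).
  apply: (integrable_pushforward (phi := (id : Omega -> G))) => //.
  exact/measurable_EFinP.
have I12 : L1 (m1 \x m2)%E (fun z => eta z.1 * z.2).
  apply/integrable12ltyP; first exact/measurable_EFinP.
  have mabs : measurable_fun [set: measurableTypeR R] (fun y : measurableTypeR R => `|y%:E|%E).
    by apply: measurableT_comp => //; exact/measurable_EFinP.
  under eq_integral => x _.
    under eq_integral => y _ do rewrite /= normrM EFinM.
    rewrite ge0_integralZl//; over.
  have /integrableP[_ lty1] := Ieta1.
  have /integrableP[_ lty2] := normal_L1_id sigma_neq0.
  rewrite ge0_integralZr//.
  - rewrite lte_mul_pinfty//.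
    - exact: integral_ge0.
    - rewrite ge0_fin_numE//; exact: integral_ge0.
  - have meG : measurable_fun [set: G] (EFin \o (eta : G -> R)) by exact/measurable_EFinP.
    exact: (measurableT_comp (@abse_measurable _ _) meG).
  - exact: integral_ge0.
have E12 : \int[(m1 \x m2)%E]_z (eta z.1 * z.2) = 0.
  have [_ <-] := L1_iterated1 I12.
  transitivity (\int[m1]_x (0 : R)); last by rewrite Rintegral_cst// mul0r.
  apply: eq_Rintegral => x _.
  by rewrite /= RintegralZl//= ?normal_mean ?mulr0//; exact: normal_L1_id.
have IY : L1 (distribution P Y) (fun z => eta z.1 * z.2).
  have /integrableP[_ lty] := I12.
  apply/integrableP; split; first exact/measurable_EFinP.
  by rewrite (eq_measure_integral (m1 \x m2)%E)// => A mA _; exact: m12.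
have IP : L1 P (fun w => eta w * Delta w).
  have /integrableP[_ lty] := IY.
  apply/integrableP; split.
    apply/measurable_EFinP; apply: measurable_funM => //.
    exact: L1_measurable Ieta.
  move: lty; rewrite ge0_integral_distribution//.
  by apply: measurableT_comp => //; exact/measurable_EFinP.
split=> //; rewrite -E12 /Rintegral; congr fine.
rewrite -(eq_measure_integral _ (m1 := distribution P Y))// => [|A mA _]; last exact: m12.
rewrite integral_distribution//.
exact/measurable_EFinP.
Qed.

End increments.

(** * Orthogonality of stochastic integrals to the past *)

Section ito_orthogonality.
Context {R : realType} {d : measure_display} {Omega : measurableType d}.
Variables (P : probability Omega R) (T : R) (F : R -> set (set Omega)).
Variables (W : R -> Omega -> R).
Hypotheses (filtF : complete_filtration P T F).
Hypotheses (W_bm : is_brownian_motion P T F W).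

Definition centered (f : Omega -> R) := L1 P f /\ \int[P]_w f w = 0.

Lemma centered0 : centered (fun=> 0).
Proof.
split; first exact: integrable0.
by rewrite Rintegral_cst// mul0r.
Qed.

Lemma centeredD f g : centered f -> centered g -> centered (fun w => f w + g w).
Proof.
move=> [If f0] [Ig g0]; split; first exact: L1D.
by rewrite RintegralD// f0 g0 addr0.
Qed.

Lemma centered_sum n (f : 'I_n -> Omega -> R) : (forall i, centered (f i)) ->
  centered (fun w => \sum_(i < n) f i w).
Proof.
move=> cf; elim: n f cf => [|n ih] f cf.
  under [X in centered X]eq_fun do rewrite big_ord0; exact: centered0.
under [X in centered X]eq_fun do rewrite big_ord_recr/=.
by apply: centeredD => //; exact: ih.
Qed.

Lemma simple_time_bounds phi i : is_simple_predictable T F phi ->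
  (i <= sp_size phi)%N -> 0 <= sp_time phi i <= T.
Proof.
move=> [t0 tn tS _ _] ni; apply/andP; split.
  elim: i ni => [//|i ih] ni.
  by rewrite (le_trans (ih (ltnW ni)))// tS.
apply: le_trans tn; rewrite -(subnKC ni).
have : (i + (sp_size phi - i) <= sp_size phi)%N by rewrite subnKC.
elim: (sp_size phi - i)%N => [|k ih]; first by rewrite addn0.
by rewrite addnS => ikn; rewrite (le_trans (ih (ltnW ikn)))// tS.
Qed.

(** Each interval of the partition contributes either nothing (it lies before
[s]) or a Brownian increment that starts at [max (sp_time phi i) s], a time at
which both [xi] and the coefficient are known. *)
Lemma simple_integral_orthogonal phi (s : R) (xi : Omega -> R) :
  is_simple_predictable T F phi -> 0 <= s <= T ->
  measurable_at F s xi -> L1 P xi ->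
  centered (fun w => xi w *
    (simple_integral W phi T w - simple_integral W phi s w)).
Proof.
move=> Hphi s0T mxi Ixi; have [_ _ tS mcoef bcoef] := Hphi.
have -> : (fun w => xi w * (simple_integral W phi T w - simple_integral W phi s w))
  = (fun w => \sum_(i < sp_size phi) xi w * sp_coef phi i w *
     (W (Num.min (sp_time phi i.+1) T) w - W (Num.min (sp_time phi i) T) w -
      (W (Num.min (sp_time phi i.+1) s) w - W (Num.min (sp_time phi i) s) w))).
  apply/funext => w; rewrite /simple_integral -sumrB mulr_sumr.
  by apply: eq_bigr => i _; ring.
apply: centered_sum => -[i ni] /=.
have /andP[ti0 tiT] := simple_time_bounds Hphi (ltnW ni).
have /andP[tSi0 tSiT] := simple_time_bounds Hphi ni.
have tiSi := tS _ ni; have /andP[s0 sT] := s0T.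
rewrite (min_idPl tiT) (min_idPl tSiT).
have [tSis|stSi] := leP (sp_time phi i.+1) s.
  rewrite (min_idPl (le_trans tiSi tSis)).
  under [X in centered X]eq_fun do rewrite subrr mulr0.
  exact: centered0.
pose u := Num.max (sp_time phi i) s.
have -> : (fun w => xi w * sp_coef phi i w *
    (W (sp_time phi i.+1) w - W (sp_time phi i) w -
      (W s w - W (Num.min (sp_time phi i) s) w))) =
  (fun w => xi w * sp_coef phi i w * (W (sp_time phi i.+1) w - W u w)).
  by apply/funext => w; rewrite /u; case: leP => _; ring.
have : u <= sp_time phi i.+1 by rewrite /u ge_max tiSi ltW.
rewrite le_eqVlt => /predU1P[->|u_lt].
  under [X in centered X]eq_fun do rewrite subrr mulr0.
  exact: centered0.
have u0 : 0 <= u by rewrite /u le_max ti0.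
have uT : u <= T by rewrite /u ge_max tiT.
have u0T : 0 <= u <= T by rewrite u0.
have mxi_u : measurable_at F u xi.
  by apply: (measurable_at_le filtF _ _ _ mxi) => //; rewrite /u le_max lexx orbT.
have mc_u : measurable_at F u (sp_coef phi i).
  by apply: (measurable_at_le filtF _ _ _ (mcoef _ ni)) => //; rewrite /u le_max lexx.
apply: (increment_orthogonal filtF W_bm) => //.
  exact: (@measurable_funM _ (g_sigma_algebraType (F u)) R setT
    xi (sp_coef phi i)).
have [K bK] := bcoef _ ni.
apply: (@L1_le _ _ _ _ _ (fun w => K * `|xi w|)).
- apply: measurable_funM; first exact: L1_measurable Ixi.
  exact: (measurable_at_measurable filtF u0T).
- by move=> w; rewrite normrM mulrC ler_wpM2r.
- by apply: L1Z; exact: (integrable_norm Ixi).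
Qed.

Lemma rv_norm_lt_L2 (f : Omega -> R) (e : R) : measurable_fun setT f ->
  (rv_norm P f < e%:E)%E -> L2 P f /\ \int[P]_w f w ^+ 2 <= e ^+ 2.
Proof.
rewrite /rv_norm => mf fe.
have I0 : (0 <= \int[P]_w ((f w) ^+ 2)%:E)%E.
  by apply: integral_ge0 => w _; rewrite lee_fin sqr_ge0.
have e0 : 0 <= e by rewrite -lee_fin (le_trans (sqrte_ge0 _) (ltW fe)).
have If : (\int[P]_w ((f w) ^+ 2)%:E <= (e ^+ 2)%:E)%E.
  by rewrite -(sqr_sqrte I0) EFin_expe lee_sqr ?sqrte_ge0// ?lee_fin// ltW.
have L2f : L2 P f by apply: L2P => //; rewrite (le_lt_trans If)// ltry.
by split=> //; rewrite -lee_fin -L2_sqrE.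
Qed.

Lemma measurable_simple_integral phi (t : R) : is_simple_predictable T F phi ->
  0 <= t <= T -> measurable_fun setT (simple_integral W phi t).
Proof.
move=> Hphi /andP[t0 tT]; have [pW _ _ _ _] := W_bm.
have [_ _ _ mcoef _] := Hphi.
have mW i : (i <= sp_size phi)%N ->
    measurable_fun setT (W (Num.min (sp_time phi i) t)).
  move=> ni; have /andP[ti0 tiT] := simple_time_bounds Hphi ni.
  by apply: (progressive_measurable filtF) => //; rewrite le_min ti0 t0 ge_min tiT.
apply: measurable_sum => -[i ni]; apply: measurable_funM => /=.
  apply: (measurable_at_measurable filtF (t := sp_time phi i)); last exact: mcoef.
  exact: simple_time_bounds (ltnW ni).
by apply: measurable_funB; apply: mW => //; exact: ltnW.
Qed.

(** The claim is exact for simple integrals, so the expectation equals minus the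
pairing of [xi] with an approximation error that tends to 0 in [L2]. *)
Lemma ito_integral_orthogonal Z M (s : R) (xi : Omega -> R) :
  is_ito_integral P T F W Z M -> 0 <= s <= T ->
  measurable_at F s xi -> L2 P xi ->
  centered (fun w => xi w * (M T w - M s w)).
Proof.
move=> [pM _ [phi [Hphi _ cvM]]] s0T mxi L2xi.
have /andP[s0 sT] := s0T.
have T0T : 0 <= T <= T by rewrite lexx (le_trans s0).
have Ixi : L1 P xi by exact: L2_L1.
pose r k w := (simple_integral W (phi k) T w - M T w)
            - (simple_integral W (phi k) s w - M s w).
have approx (e : R) : 0 < e -> exists k, L2 P (r k) /\ \int[P]_w (r k w) ^+ 2 <= 4 * e ^+ 2.
  move=> e0.
  have near_e t : 0 <= t <= T -> \forall k \near \oo,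
      L2 P (fun w => simple_integral W (phi k) t w - M t w) /\
      \int[P]_w (simple_integral W (phi k) t w - M t w) ^+ 2 <= e ^+ 2.
    move=> t0T; have /fine_cvgP[finN cvN] := cvM t t0T.
    near=> k; apply: rv_norm_lt_L2.
      apply: measurable_funB; first exact: measurable_simple_integral.
      exact: (progressive_measurable filtF).
    have fk : rv_norm P (fun w => simple_integral W (phi k) t w - M t w) \is a fin_num.
      by near: k.
    rewrite -(fineK fk) lte_fin.
    near: k; have := cvgr_lt 0 cvN; apply.
    exact: e0.
  have [k [[LT nT] [Ls ns]]] : exists k,
    (L2 P (fun w => simple_integral W (phi k) T w - M T w) /\
      \int[P]_w (simple_integral W (phi k) T w - M T w) ^+ 2 <= e ^+ 2) /\
    (L2 P (fun w => simple_integral W (phi k) s w - M s w) /\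
      \int[P]_w (simple_integral W (phi k) s w - M s w) ^+ 2 <= e ^+ 2).
    by apply: (@filter_ex _ \oo); near=> k; split; near: k; exact: near_e.
  exists k; have Lr : L2 P (r k) by exact: L2B.
  split=> //.
  apply: (@le_trans _ _ (\int[P]_w (2 * (simple_integral W (phi k) T w - M T w) ^+ 2
     + 2 * (simple_integral W (phi k) s w - M s w) ^+ 2))).
    apply: le_Rintegral => //.
    - by case: Lr.
    - by apply: L1D; apply: L1Z; [case: LT|case: Ls].
    - move=> w _; rewrite /r; set a := _ - M T w; set b := _ - M s w.
      by have := sqr_ge0 (a + b); lra.
  rewrite RintegralD//; last 2 first.
  - by apply: L1Z; case: LT.
  - by apply: L1Z; case: Ls.
  by rewrite !RintegralZl//; [lra|case: Ls|case: LT].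
have decomp k : L2 P (r k) -> L1 P (fun w => xi w * (M T w - M s w)) /\
    \int[P]_w (xi w * (M T w - M s w)) = - \int[P]_w (xi w * r k w).
  move=> Lr; have [I1 E1] := simple_integral_orthogonal (Hphi k) s0T mxi Ixi.
  have I2 := L2M L2xi Lr.
  have -> : (fun w => xi w * (M T w - M s w)) = (fun w => xi w *
    (simple_integral W (phi k) T w - simple_integral W (phi k) s w) - xi w * r k w).
    by apply/funext => w; rewrite /r; ring.
  by split; [exact: L1B|rewrite RintegralB// E1 sub0r].
have [k0 [Lr0 _]] := approx 1 ltr01.
split; first by have [] := decomp _ Lr0.
apply/eqP; rewrite -normr_le0; apply/ler_addgt0Pr => e e0; rewrite add0r.
pose A := \int[P]_w xi w ^+ 2.
have A0 : 0 <= A by apply: Rintegral_ge0 => w _; exact: sqr_ge0.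
(* Young's inequality with weight [dl] bounds the pairing with an error of
   norm [2 * dl] by [dl * (A + 4)]. *)
pose dl := e / (A + 4).
have dl0 : 0 < dl by rewrite divr_gt0// ltr_wpDl.
have [k [Lr nr]] := approx dl dl0.
have [_ ->] := decomp k Lr; rewrite normrN.
apply: (@le_trans _ _ (\int[P]_w (dl * xi w ^+ 2 + dl^-1 * r k w ^+ 2))).
  apply: le_trans (le_normr_Rintegral measurableT (L2M L2xi Lr)) _.
  apply: le_Rintegral => //.
  - exact: (integrable_norm (L2M L2xi Lr)).
  - by apply: L1D; apply: L1Z; [case: L2xi|case: Lr].
  - move=> w _; rewrite ler_norml.
    have -> : dl^-1 * r k w ^+ 2 = dl * (dl^-1 * r k w) ^+ 2.
      by field; rewrite gt_eqF.
    have -> : xi w * r k w = dl * (xi w * (dl^-1 * r k w)).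
      by field; rewrite gt_eqF.
    set b := dl^-1 * _; rewrite -mulrDr -mulrN !ler_pM2l//.
    by have := sqr_ge0 (xi w + b); have := sqr_ge0 (xi w - b);
      have := sqr_ge0 (xi w); have := sqr_ge0 b; lra.
rewrite RintegralD//; last 2 first.
- by apply: L1Z; case: L2xi.
- by apply: L1Z; case: Lr.
rewrite !RintegralZl//; [|by case: Lr|by case: L2xi].
have -> : e = dl * A + dl^-1 * (4 * dl ^+ 2).
  by rewrite /dl; field; rewrite !gt_eqF// ltr_wpDl.
by rewrite lerD2l ler_pM2l ?invr_gt0.
Unshelve. all: by end_near. Qed.

End ito_orthogonality.

(** * Lebesgue measure on the time interval *)

Section time_measure.
Context {R : realType}.
Local Notation mu := (@lebesgue_measure R).

Lemma lebesgue_itv_lty (T : R) : (mu `[0%R, T]%classic < +oo)%E.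
Proof. by rewrite lebesgue_measure_itv/=; case: ifP => _; rewrite ?ltry// -EFinB ltry. Qed.

Lemma measurable_time_itv (T : R) :
  measurable (`[0%R, T]%classic : set (measurableTypeR R)).
Proof. exact: measurable_itv. Qed.

(** Restricting the measure instead of the domain of integration gives a finite
measure on the whole line: constants are integrable, and the Fubini theorems
apply to [P \x time_measure T] without domains. *)
Definition time_measure (T : R) : set (measurableTypeR R) -> \bar R :=
  mfrestr (measurable_time_itv T) (lebesgue_itv_lty T).

HB.instance Definition _ (T : R) := FiniteMeasure.copy (time_measure T)
  (mfrestr (measurable_time_itv T) (lebesgue_itv_lty T)).

Variables (T : R).
Hypothesis T_gt0 : 0 < T.
Local Notation lam := (time_measure T).
Local Notation D := (`[0, T]%classic).

Lemma time_measureE (A : set R) : A `<=` D -> lam A = mu A.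
Proof. by move=> AD; rewrite /time_measure /mfrestr /mrestr setIidl. Qed.

Lemma time_measureT : lam setT = T%:E.
Proof.
rewrite /time_measure /mfrestr /mrestr setTI lebesgue_measure_itv/= lte_fin T_gt0.
by rewrite -EFinB subr0.
Qed.

Lemma time_integralD (f : R -> \bar R) :
  (\int[lam]_(t in D) f t = \int[mu]_(t in D) f t)%E.
Proof. by apply: eq_measure_integral => A _ AD; exact: time_measureE. Qed.

Lemma time_integral (A : set R) (f : R -> \bar R) :
  (forall t, ~ D t -> f t = 0%E) ->
  (\int[lam]_(t in A) f t = \int[mu]_(t in A) f t)%E.
Proof.
move=> f0; rewrite [LHS]integral_mkcond [RHS]integral_mkcond.
have fD : f \_ A = (f \_ A) \_ D.
  apply/funext => t; rewrite /patch; have [//|tD] := boolP (t \in D).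
  by case: ifP => // _; rewrite f0//; move: tD; rewrite notin_setE.
by rewrite fD -[LHS]integral_mkcond -[RHS]integral_mkcond time_integralD.
Qed.

Lemma time_Rintegral (A : set R) (f : R -> R) : (forall t, ~ D t -> f t = 0) ->
  \int[lam]_(t in A) f t = \int[mu]_(t in A) f t.
Proof. by move=> f0; rewrite /Rintegral time_integral// => t /f0 ->. Qed.

Lemma Rintegral_split (f : R -> R) (t : R) : L1 lam f ->
  \int[lam]_s f s = \int[lam]_(s in `]-oo, t]) f s + \int[lam]_(s in `]t, +oo[) f s.
Proof.
move=> If.
have -> : [set: R] = `]-oo, t]%classic `|` `]t, +oo[%classic.
  apply/seteqP; split=> // s _ /=; rewrite !in_itv/= andbT.
  by case: (leP s t); [left|right].
apply: Rintegral_setU => //.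
- by apply: integrableS If => //; exact: measurableU.
- rewrite disj_set2E; apply/eqP/seteqP; split=> // s /= [].
  by rewrite !in_itv/= andbT leNgt => /negP.
Qed.

(** Cauchy-Schwarz against the constant 1: integrate [2 * m * f <= m ^+ 2 + f ^+ 2]
with [m] the integral of [f] divided by [T]. *)
Lemma sqr_Rintegral_le (A : set (measurableTypeR R)) (f : R -> R) : measurable A -> L2 lam f ->
  (\int[lam]_(t in A) f t) ^+ 2 <= T * \int[lam]_t f t ^+ 2.
Proof.
move=> mA L2f; have [mf If2] := L2f; have If := L2_L1 L2f.
set J := \int[lam]_(t in A) f t; pose m := J / T.
have IA : L1 lam (f \_ A) by exact: L1_restrict.
have : \int[lam]_t (2 * m * (f \_ A) t) <= \int[lam]_t (m ^+ 2 + f t ^+ 2).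
  apply: le_Rintegral => //.
  - exact: L1Z.
  - by apply: L1D => //; exact: L1_cst.
  move=> t _; rewrite /patch; case: ifPn => _.
    by have := sqr_ge0 (m - f t); lra.
  by rewrite /= mulr0 addr_ge0// sqr_ge0.
rewrite RintegralZl// -Rintegral_mkcond -/J RintegralD//; last first.
  exact: L1_cst.
rewrite Rintegral_cst//= time_measureT/= /m => le1.
have -> : J ^+ 2 = T * (2 * (J / T) * J - (J / T) ^+ 2 * T).
  by field; rewrite gt_eqF.
by rewrite ler_pM2l//; lra.
Qed.

(** Both sides are the integral of [a s * b r] over the triangle [s < r]. *)
Lemma time_parts (a b : R -> R) : L1 lam a -> L1 lam b ->
  \int[lam]_s (a s * \int[lam]_(r in `]s, +oo[) b r) =
  \int[lam]_r (b r * \int[lam]_(s in `]-oo, r[) a s).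
Proof.
move=> Ia Ib.
pose f (z : measurableTypeR R * measurableTypeR R) : R :=
  a z.1 * b z.2 * \1_[set z : R * R | z.1 < z.2] z.
have ma := L1_measurable Ia; have mb := L1_measurable Ib.
have mlt : measurable [set z : measurableTypeR R * measurableTypeR R | z.1 < z.2].
  have mlt : measurable_fun [set: measurableTypeR R * measurableTypeR R]
      (fun z => z.1 < z.2) by exact: measurable_fun_ltr.
  rewrite (_ : mkset _ = setT `&`
    (fun z : measurableTypeR R * measurableTypeR R => z.1 < z.2) @^-1` [set true]).
    exact: mlt.
  by rewrite setTI.
have mab : measurable_fun setT
    (fun z : measurableTypeR R * measurableTypeR R => a z.1 * b z.2).
  by apply: measurable_funM; exact: measurableT_comp.
have Iab : L1 (lam \x lam)%E (fun z => a z.1 * b z.2).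
  apply/integrable12ltyP; first exact/measurable_EFinP.
  under eq_integral => x _.
    under eq_integral => y _ do rewrite /= normrM EFinM.
    rewrite ge0_integralZl//; last first.
      by have := integrable_norm Ib => /measurable_int.
    over.
  have /integrableP[_ lty1] := Ia.
  have /integrableP[_ lty2] := Ib.
  rewrite ge0_integralZr//.
  - rewrite lte_mul_pinfty//.
    - exact: integral_ge0.
    - rewrite ge0_fin_numE//; exact: integral_ge0.
  - by have := integrable_norm Ia => /measurable_int.
  - exact: integral_ge0.
have If : L1 (lam \x lam)%E f.
  apply: L1_le (integrable_norm Iab); first exact: measurable_funM.
  move=> z; rewrite /f normrM ler_piMr// indicE.
  by case: (_ \in _); rewrite ?normr1 ?normr0.
have [_ E1] := L1_iterated1 If; have [_ E2] := L1_iterated2 If.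
have memlt s r : ((s, r) \in [set z : R * R | z.1 < z.2]) = (s < r).
  by apply/idP/idP; rewrite inE.
transitivity (\int[lam]_x \int[lam]_y f (x, y)).
  apply: eq_Rintegral => s _; rewrite Rintegral_mkcond -RintegralZl//; last first.
    by apply: L1_restrict => //; exact: measurable_itv.
  apply: eq_Rintegral => r _; rewrite /f /= indicE memlt /patch mem_setE/= in_itv/= andbT.
  by case: (s < r); rewrite ?mulr1 ?mulr0.
rewrite E1 -E2; apply: eq_Rintegral => r _.
rewrite [in RHS]Rintegral_mkcond -[RHS]RintegralZl//; last first.
  by apply: L1_restrict => //; exact: measurable_itv.
apply: eq_Rintegral => s _; rewrite /f /= indicE memlt /patch mem_setE/= in_itv/=.
by case: (s < r); rewrite ?mulr1 ?mulr0// mulrC.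
Qed.

Lemma time_Rintegral_open (a : R -> R) (t : R) : L1 lam a ->
  (forall s, ~ D s -> a s = 0) ->
  \int[lam]_(s in `]-oo, t[) a s = \int[lam]_(s in `]-oo, t]) a s.
Proof.
move=> Ia a0; rewrite !time_Rintegral// Rintegral_itv_bndo_bndc//.
have /integrableP[ma lta] : lam.-integrable `]-oo, t[ (EFin \o a).
  by apply: (integrableS _ _ _ Ia) => //; exact: measurable_itv.
apply/integrableP; split=> //; rewrite -time_integral// => s /a0 as0.
by rewrite /= as0 normr0.
Qed.

Lemma time_Rintegral_prefix (g : R -> R) (t : R) : 0 <= t <= T ->
  \int[lam]_(s in `]-oo, t]) (if 0 <= s <= T then g s else 0) =
  \int[mu]_(s in `[0, t]) g s.
Proof.
move=> /andP[t0 tT]; rewrite time_Rintegral; last first.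
  by move=> s /negP; rewrite /= in_itv/= => /negbTE ->.
rewrite Rintegral_mkcond [RHS]Rintegral_mkcond; congr Rintegral.
apply/funext => s; rewrite /patch !mem_setE/= !in_itv/=.
have [s0|s0] := leP 0 s; last by rewrite if_same.
by have [st|//] := leP s t; rewrite (le_trans st tT).
Qed.

End time_measure.

(** * Processes as functions on the product space *)

Section product_lemmas.
Context {R : realType} {d : measure_display} {Omega : measurableType d}.
Variables (P : probability Omega R) (T : R).
Hypothesis T_gt0 : 0 < T.
Local Notation lam := (time_measure T).
Local Notation nu := (P \x lam)%E.
Implicit Types f : Omega * measurableTypeR R -> R.

Lemma ae_filter_product : Filter (nbhs (almost_everywhere nu)).
Proof. exact: (ae_filter_ringOfSetsType nu). Qed.

Lemma ae_fst (Q : Omega -> R -> Prop) :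
  {ae P, forall w, forall t, Q w t} -> {ae nu, forall z, Q z.1 z.2}.
Proof.
move=> [N [mN PN sub]]; exists (N `*` setT); split.
- exact: measurableX.
- by rewrite product_measure1E//= PN mul0e.
- move=> [w t] /= nQ; split=> //=; apply: sub => /= allQ; exact: nQ.
Qed.

Lemma L1_fst (h : Omega -> R) : L1 P h ->
  L1 nu (fun z => h z.1) /\ \int[nu]_z h z.1 = T * \int[P]_w h w.
Proof.
move=> Ih; have mh := L1_measurable Ih.
have Inu : L1 nu (fun z => h z.1).
  apply/integrable12ltyP; first exact/measurable_EFinP/(measurableT_comp mh).
  rewrite (eq_integral (fun x => `|(h x)%:E| * T%:E)%E); last first.
    move=> x _; rewrite -(time_measureT T_gt0).
    exact: (integral_cst lam measurableT `|(h x)%:E|%E).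
  rewrite ge0_integralZr//; last by rewrite lee_fin ltW.
    have /integrableP[_ ?] := Ih; apply: lte_mul_pinfty => //;
      rewrite ?ge0_fin_numE ?ltry//; exact: integral_ge0.
  by apply: measurableT_comp => //; exact/measurable_EFinP.
split=> //; have [_ <-] := L1_iterated1 Inu.
rewrite -RintegralZl//; apply: eq_Rintegral => w _.
by rewrite /= Rintegral_cst//= time_measureT//= mulrC.
Qed.

End product_lemmas.
#[global] Hint Extern 0 (Filter (nbhs (almost_everywhere _))) =>
  (exact: ae_filter_product) : typeclass_instances.

Section time_cut.
Context {R : realType} {d : measure_display} {Omega : measurableType d}.
Variables (P : probability Omega R) (T : R) (F : R -> set (set Omega)).
Hypothesis T_gt0 : 0 < T.
Hypothesis filtF : complete_filtration P T F.
Local Notation lam := (time_measure T).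
Local Notation nu := (P \x lam)%E.
Local Notation mu := (@lebesgue_measure R).

(** A process only matters on [0, T]; its extension by zero is a function that is
measurable on the whole product space.  The sample point comes first, as the
inner integral of [process_norm] is the one over time. *)
Definition time_cut (f : R -> Omega -> R) : Omega * measurableTypeR R -> R :=
  fun z => if 0 <= z.2 <= T then f z.2 z.1 else 0.

Lemma time_cutE f w (t : R) : 0 <= t <= T -> time_cut f (w, t) = f t w.
Proof. by rewrite /time_cut /= => ->. Qed.

Lemma time_cut0 f w (t : R) : ~~ (0 <= t <= T) -> time_cut f (w, t) = 0.
Proof. by rewrite /time_cut /= => /negbTE ->. Qed.

Lemma measurable_time_cut f : progressive T F f -> measurable_fun setT (time_cut f).
Proof.
have T0T : 0 <= T <= T by rewrite lexx ltW.
move=> /(_ T T0T) mf; pose G := g_sigma_algebraType (F T).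
have mid : measurable_fun [set: Omega] (id : Omega -> G).
  move=> _ B mB; rewrite setTI.
  have [_ + _ _ _] := filtF; apply; first exact: T0T.
  by rewrite -(filtration_sigma filtF).
pose E : set (Omega * measurableTypeR R) := setT `*` `[0, T]%classic.
have mE : measurable E by apply: measurableX => //; exact: measurable_itv.
have mfE : measurable_fun E (fun z => f z.2 z.1).
  apply: (@measurable_comp _ _ _ _ _ _ (`[0, T] `*` [set: G])
    (fun z : R * G => f z.1 z.2) E
    (fun z : Omega * measurableTypeR R => (z.2, z.1 : G))) => //.
  - by apply: measurableX.
  - by move=> _ [[w t] [_ tT] <-]; exact: (conj tT I).
  - apply: measurable_funTS; apply: measurable_fun_pair => //.
    exact: (measurableT_comp mid measurable_fst).
have -> : time_cut f = (fun z => f z.2 z.1) \_ E.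
  apply/funext => -[w t]; rewrite /time_cut /patch /E /= in_setX in_setT/= mem_setE/= in_itv/=.
  by case: ifP.
exact/(measurable_restrictT _ mE).
Qed.

Lemma process_norm_time_cut f : progressive T F f ->
  (process_norm P T f = sqrte (\int[nu]_z ((time_cut f z) ^+ 2)%:E))%E.
Proof.
move=> pf; rewrite /process_norm; congr sqrte.
have msq : measurable_fun setT (fun z => ((time_cut f z) ^+ 2)%:E).
  by apply/measurable_EFinP; apply: measurable_funX; exact: measurable_time_cut.
rewrite (@fubini_tonelli1 _ _ _ _ _ P lam _ msq); last first.
  by move=> z; rewrite lee_fin sqr_ge0.
apply: eq_integral => w _; rewrite /fubini_F time_integral; last first.
  move=> t /negP; rewrite /= in_itv/= => nt; by rewrite time_cut0// expr0n.
rewrite integral_mkcond; apply: eq_integral => t _.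
rewrite /patch mem_setE/= in_itv/= /time_cut /=.
by case: ifP => //; rewrite expr0n.
Qed.

Lemma L2_time_cut f : square_integrable_process P T F f -> L2 nu (time_cut f).
Proof.
move=> [pf]; rewrite process_norm_time_cut// => fin.
apply: L2P; first exact: measurable_time_cut.
have I0 : (0 <= \int[nu]_z ((time_cut f z) ^+ 2)%:E)%E.
  by apply: integral_ge0 => z _; rewrite lee_fin sqr_ge0.
by rewrite -ge0_fin_numE// -sqrte_fin_num// ge0_fin_numE// sqrte_ge0.
Qed.

Lemma process_normE f : progressive T F f -> L2 nu (time_cut f) ->
  (process_norm P T f = (Num.sqrt (\int[nu]_z (time_cut f z) ^+ 2))%:E)%E.
Proof. by move=> pf Lf; rewrite process_norm_time_cut// L2_sqrE. Qed.

End time_cut.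

(** * Duality between the state and the costate *)

Section adapted_orthogonality.
Context {R : realType} {d : measure_display} {Omega : measurableType d}.
Variables (P : probability Omega R) (T : R) (F : R -> set (set Omega)).
Variables (W : R -> Omega -> R).
Hypotheses (filtF : complete_filtration P T F).
Hypotheses (W_bm : is_brownian_motion P T F W).
Local Notation lam := (time_measure T).
Local Notation nu := (P \x lam)%E.

(** Almost every time section of [f] is square integrable, so the orthogonality
at a fixed time applies under the outer integral over time. *)
Lemma ito_increment_orthogonal Z1 M1 Z2 M2 (f dM : R -> Omega -> R) :
  is_ito_integral P T F W Z1 M1 -> is_ito_integral P T F W Z2 M2 ->
  (forall t : R, 0 <= t <= T -> measurable_at F t (f t)) ->
  (forall (t : R) w, 0 <= t <= T ->
    dM t w = (M1 T w - M1 t w) - (M2 T w - M2 t w)) ->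
  L2 nu (time_cut T f) -> L2 nu (time_cut T dM) ->
  \int[nu]_z (time_cut T f z * time_cut T dM z) = 0.
Proof.
move=> ito1 ito2 mf dME Lf LdM.
have [_ <-] := L1_iterated2 (L2M Lf LdM).
have [I2 _] := L1_iterated2 (L2M Lf LdM).
rewrite (@ae_eq_Rintegral _ _ _ lam _ (fun=> 0)).
- by rewrite Rintegral_cst// mul0r.
- exact: L1_measurable I2.
- exact: measurable_cst.
apply: filterS (L2_sections2 Lf) => t.
have [t0T|nt] := boolP (0 <= t <= T).
  have -> : (fun w => time_cut T f (w, t)) = f t by apply/funext => w; rewrite time_cutE.
  move=> Lft.
  have [_ E1] := ito_integral_orthogonal filtF W_bm ito1 t0T (mf _ t0T) Lft.
  have [_ E2] := ito_integral_orthogonal filtF W_bm ito2 t0T (mf _ t0T) Lft.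
  have [I1 _] := ito_integral_orthogonal filtF W_bm ito1 t0T (mf _ t0T) Lft.
  have [I3 _] := ito_integral_orthogonal filtF W_bm ito2 t0T (mf _ t0T) Lft.
  transitivity (\int[P]_w (f t w * (M1 T w - M1 t w) - f t w * (M2 T w - M2 t w))).
    by apply: eq_Rintegral => w _; rewrite !time_cutE// dME// mulrBr.
  by rewrite RintegralB// E1 E2 subr0.
move=> _; transitivity (\int[P]_w (0 : R)); last by rewrite Rintegral_cst// mul0r.
by apply: eq_Rintegral => w _; rewrite time_cut0// mul0r.
Qed.

End adapted_orthogonality.

Section duality.
Context {R : realType} {d : measure_display} {Omega : measurableType d}.
Variables (P : probability Omega R) (T : R).
Hypothesis T_gt0 : 0 < T.
Local Notation lam := (time_measure T).
Local Notation nu := (P \x lam)%E.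
Local Notation zt := (Omega * measurableTypeR R)%type.

Variables (x y dm a b : R -> Omega -> R) (xT yT : Omega -> R).
Local Notation cut := (time_cut T).
Hypotheses (La : L2 nu (cut a)) (Lb : L2 nu (cut b)).
Hypotheses (Lx : L2 nu (cut x)) (Ly : L2 nu (cut y)) (mdm : measurable_fun setT (cut dm)).
Hypotheses (mxT : measurable_fun setT xT) (LyT : L2 P yT).
Hypothesis xE : {ae P, forall w, xT w = \int[lam]_s cut a (w, s) /\
  forall t : R, 0 <= t <= T -> x t w = \int[lam]_(s in `]-oo, t]) cut a (w, s)}.
Hypothesis yE : {ae P, forall w, forall t : R, 0 <= t <= T ->
  yT w - y t w - dm t w = \int[lam]_(s in `]t, +oo[) cut b (w, s)}.

Let B w := \int[lam]_s cut b (w, s) ^+ 2.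

Let B_L1 : L1 P B /\ \int[P]_w B w = \int[nu]_z cut b z ^+ 2.
Proof. by case: Lb => _ Ib; exact: L1_iterated1. Qed.

(** For almost every path, [y + dm] is the terminal value minus the integral of
the drift over [t, T]. *)
Let tail_le : {ae nu, forall z,
  (cut y z + cut dm z) ^+ 2 <= 2 * yT z.1 ^+ 2 + 2 * (T * B z.1)}.
Proof.
have tail_fst : {ae P, forall w, forall t,
    (cut y (w, t) + cut dm (w, t)) ^+ 2 <= 2 * yT w ^+ 2 + 2 * (T * B w)}.
  apply: filterS2 yE (L2_sections1 Lb) => w yEw Lbw t.
  have B0 : 0 <= B w by apply: Rintegral_ge0 => s _; exact: sqr_ge0.
  have [t0T|nt] := boolP (0 <= t <= T); last first.
    rewrite !time_cut0// addr0 expr0n/=; apply: addr_ge0.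
      by rewrite mulr_ge0// sqr_ge0.
    by rewrite !mulr_ge0// ltW.
  rewrite !time_cutE//.
  have -> : y t w + dm t w = yT w - \int[lam]_(s in `]t, +oo[) cut b (w, s).
    by rewrite -yEw//; ring.
  have := @sqr_Rintegral_le _ _ T_gt0 `]t, +oo[%classic _ (measurable_itv _) Lbw.
  set I := \int[_]_(_ in _) _; rewrite -/(B w) => le_I.
  by have := sqr_ge0 (yT w + I); lra.
by apply: filterS (ae_fst T tail_fst) => -[w t].
Qed.

Let bound_L1 : L1 nu (fun z => 2 * yT z.1 ^+ 2 + 2 * (T * B z.1)).
Proof.
apply: L1D; apply: L1Z.
  by case: LyT => _ IyT; have [] := L1_fst T_gt0 IyT.
by apply: L1Z; have [] := L1_fst T_gt0 B_L1.1.
Qed.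

(** The square integrability of the martingale increments as functions of time
and chance is read off the equation, which expresses them through [yT], [y] and
the drift. *)
Lemma martingale_increment_L2 : L2 nu (cut dm).
Proof.
have Lsum : L2 nu (fun z => cut y z + cut dm z).
  have ms : measurable_fun setT (fun z => cut y z + cut dm z).
    by apply: measurable_funD => //; case: Ly.
  split=> //; apply: (ae_le_L1 _ bound_L1); first exact: measurable_funX.
  by apply: filterS tail_le => z; rewrite ger0_norm// sqr_ge0.
have := L2B Lsum Ly; congr L2.
by apply/funext => z; ring.
Qed.

Lemma terminal_state_L2 : L2 P xT /\
  \int[P]_w xT w ^+ 2 <= T * \int[nu]_z cut a z ^+ 2.
Proof.
have [_ Ia2] := La; have [IA EA] := L1_iterated1 Ia2.
have le_xT : {ae P, forall w, xT w ^+ 2 <= T * \int[lam]_s cut a (w, s) ^+ 2}.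
  apply: filterS2 xE (L2_sections1 La) => w [-> _] Law.
  exact: sqr_Rintegral_le.
have LxT : L2 P xT.
  split=> //; apply: (ae_le_L1 _ (L1Z T IA)); first exact: measurable_funX.
  by apply: filterS le_xT => w; rewrite ger0_norm// sqr_ge0.
split=> //; rewrite -EA -RintegralZl//.
by apply: ae_le_Rintegral => //; [case: LxT|exact: L1Z].
Qed.

(** Adding [2 * y * dm], which integrates to 0, to [y ^+ 2] gives at most
[(y + dm) ^+ 2], which involves only the terminal value and the drift: this is
the contraction property of the conditional expectation. *)
Lemma adjoint_L2_le : \int[nu]_z (cut y z * cut dm z) = 0 ->
  \int[nu]_z cut y z ^+ 2 <=
  T * (2 * \int[P]_w yT w ^+ 2 + 2 * (T * \int[nu]_z cut b z ^+ 2)).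
Proof.
move=> ort; have Ldm := martingale_increment_L2.
have Iyd := L2M Ly Ldm; have [_ Iy2] := Ly; have [_ IyT] := LyT.
have [IyT1 EyT] := L1_fst T_gt0 IyT.
have [IB EB] := B_L1; have [IB1 EB1] := L1_fst T_gt0 IB.
have -> : \int[nu]_z cut y z ^+ 2 = \int[nu]_z (cut y z ^+ 2 + 2 * (cut y z * cut dm z)).
  by rewrite RintegralD//; [rewrite RintegralZl// ort mulr0 addr0|exact: L1Z].
apply: (@le_trans _ _ (\int[nu]_z (2 * yT z.1 ^+ 2 + 2 * (T * B z.1)))).
  apply: ae_le_Rintegral => //; first by apply: L1D => //; exact: L1Z.
  by apply: filterS tail_le => z; have := sqr_ge0 (cut dm z); lra.
have I2 : L1 nu (fun z : zt => 2 * yT z.1 ^+ 2) by exact: L1Z.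
have I3 : L1 nu (fun z : zt => T * B z.1) by exact: L1Z.
rewrite RintegralD//; last exact: L1Z.
by rewrite !RintegralZl// EyT EB1 EB; lra.
Qed.

(** Integrating [a t * (yT - y t - dm t)] over time gives [xT * yT] minus the
pairings of [a] with [y] and [dm]; by [time_parts] it also equals the integral
of [b * x]. *)
Lemma terminal_pairing : \int[nu]_z (cut a z * cut dm z) = 0 ->
  \int[P]_w (xT w * yT w) =
  \int[nu]_z (cut a z * cut y z) + \int[nu]_z (cut b z * cut x z).
Proof.
move=> ort; have Ldm := martingale_increment_L2.
have Iad := L2M La Ldm; have Iay := L2M La Ly; have Ibx := L2M Lb Lx.
have [Jad Ead] := L1_iterated1 Iad.
have [Jay Eay] := L1_iterated1 Iay.
have [Jbx Ebx] := L1_iterated1 Ibx.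
have pathwise : {ae P, forall w, xT w * yT w =
    \int[lam]_t (cut a (w, t) * cut y (w, t)) + \int[lam]_t (cut a (w, t) * cut dm (w, t))
    + \int[lam]_t (cut b (w, t) * cut x (w, t))}.
  have secs : {ae P, forall w, [/\ L1 lam (fun t => cut a (w, t) * cut dm (w, t)),
      L1 lam (fun t => cut a (w, t) * cut y (w, t)),
      L1 lam (fun t => cut a (w, t)) & L1 lam (fun t => cut b (w, t))]}.
    apply: filterS2 (filterI (L1_sections1 Iad) (L1_sections1 Iay))
      (filterI (L2_sections1 La) (L2_sections1 Lb)) => w [? ?] [? ?].
    by split=> //; exact: L2_L1.
  apply: filterS3 secs xE yE => w [Iadw Iayw Iaw Ibw] [xTE xtE] ytE.
  have b0 s : ~ (`[0, T]%classic) s -> cut b (w, s) = 0.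
    by rewrite /= in_itv/= => /negP; exact: time_cut0.
  have a0 s : ~ (`[0, T]%classic) s -> cut a (w, s) = 0.
    by rewrite /= in_itv/= => /negP; exact: time_cut0.
  have := time_parts Iaw Ibw.
  have -> : \int[lam]_r (cut b (w, r) * \int[lam]_(s in `]-oo, r[) cut a (w, s)) =
      \int[lam]_t (cut b (w, t) * cut x (w, t)).
    apply: eq_Rintegral => t _; have [t0T|nt] := boolP (0 <= t <= T).
      by rewrite [cut x _]time_cutE// xtE// time_Rintegral_open.
    by rewrite [cut b _]time_cut0// !mul0r.
  move=> <-.
  have -> : \int[lam]_s (cut a (w, s) * \int[lam]_(r in `]s, +oo[) cut b (w, r)) =
     \int[lam]_s (yT w * cut a (w, s) - cut a (w, s) * cut y (w, s)
       - cut a (w, s) * cut dm (w, s)).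
    apply: eq_Rintegral => t _; have [t0T|nt] := boolP (0 <= t <= T).
      by rewrite -ytE// [cut y _]time_cutE// [cut dm _]time_cutE//; ring.
    by rewrite [cut a _]time_cut0// !(mul0r, mulr0) !subr0.
  rewrite RintegralB//; last by apply: L1B => //; exact: L1Z.
  rewrite RintegralB//; last exact: L1Z.
  by rewrite RintegralZl// -xTE; ring.
rewrite (ae_eq_Rintegral _ _ pathwise).
- rewrite RintegralD//; last exact: L1D.
  by rewrite RintegralD// Ead Eay Ebx ort addr0.
- by apply: measurable_funM => //; case: LyT.
- by apply: (@L1_measurable _ _ _ P); apply: L1D => //; exact: L1D.
Qed.

End duality.

(** * Convexity and monotone derivatives *)

Section convexity.
Context {R : realType}.
Implicit Types (f : R -> R) (H : R -> R -> R).

(** Divide the convexity inequality on the segment from [x] to [y] by the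
parameter [t] and let [t] tend to 0 from the right. *)
Lemma uniformly_convex_tangent (gamma : R) f (x y : R) :
  uniformly_convex gamma f -> derivable f x 1 ->
  f x + derive1 f x * (y - x) + gamma / 2 * (y - x) ^+ 2 <= f y.
Proof.
move=> cf dfx; set v := y - x.
have diff_fx : differentiable f x by apply/derivable1_diffP.
have dv : derivable f x v by exact: diff_derivable.
have Dv : 'D_v f x = derive1 f x * v.
  rewrite (deriveE _ diff_fx) (derive1E' diff_fx).
  have -> : 'd f x v = v *: 'd f x (1 : R).
    by rewrite -linearZ; congr ('d f x _); rewrite /GRing.scale/= mulr1.
  by rewrite /GRing.scale/= mulrC.
pose q (h : R) := h^-1 *: ((f \o shift x) (h *: v) - f x).
have cq : q h @[h --> 0^'+] --> derive1 f x * v.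
  by rewrite -Dv; apply: cvg_dnbhs_at_right; exact: dv.
pose r (h : R) := f y - f x - gamma / 2 * (1 - h) * v ^+ 2.
have cr : r h @[h --> 0^'+] --> f y - f x - gamma / 2 * v ^+ 2.
  have -> : f y - f x - gamma / 2 * v ^+ 2 = r 0 by rewrite /r subr0 mulr1.
  apply: cvg_at_right_filter; rewrite /r.
  apply: cvgB; first exact: cvg_cst.
  apply: cvgMr_tmp; apply: cvgMl_tmp.
  apply: cvgB; [exact: cvg_cst|exact: cvg_id].
have : derive1 f x * v <= f y - f x - gamma / 2 * v ^+ 2.
  apply: (ler_cvg_to cq cr); near=> h.
  have h0 : 0 < h by [].
  have h1 : h <= 1 by near: h; exact: nbhs_right_le.
  rewrite /q /r /= /GRing.scale/= ler_pdivrMl//.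
  have := cf y x h; rewrite (ltW h0) h1 => /(_ isT).
  have -> : h * v + x = h * y + (1 - h) * x by rewrite /v; ring.
  by rewrite -/v; lra.
by lra.
Unshelve. all: by end_near. Qed.

Lemma uniformly_convex_monotone (gamma : R) f (x y : R) :
  uniformly_convex gamma f -> (forall x, derivable f x 1) ->
  gamma * (x - y) ^+ 2 <= (derive1 f x - derive1 f y) * (x - y).
Proof.
move=> cf df; have := uniformly_convex_tangent y cf (df x).
by have := uniformly_convex_tangent x cf (df y); lra.
Qed.

Lemma convex_uniformly_convex0 f :
  convex_function [set: R^o] (f : R^o -> R^o) -> uniformly_convex 0 f.
Proof.
move=> cf x y t /andP[t0 t1]; rewrite !mul0r subr0.
have := cf (Itv01 t0 t1) x y (in_setT _) (in_setT _).
by rewrite !convRE.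
Qed.

Lemma lipschitz_bound f : lipschitz f ->
  exists2 K : R, 0 < K & forall x y, `|f x - f y| <= K * `|x - y|.
Proof.
move=> [M [Mreal HM]]; exists (Num.max M 0 + 1).
  by rewrite ltr_wpDl// le_max lexx orbT.
move=> x y; have MK : M < Num.max M 0 + 1 by rewrite ltr_pwDr// le_max lexx.
exact: (HM _ MK (x, y) (conj I I)).
Qed.

(** For a separable [H] the increments of one argument do not see the other one,
whose value can therefore be frozen at 0. *)
Lemma separable_partial_x H (x p : R) : separable H ->
  partial_x H x p = partial_x H x 0.
Proof.
move=> [H1 [H2 HE]]; rewrite /partial_x /derive1;
  set f := (fun _ : R => _); set g := (fun _ : R => _).
suff -> : f = g by [].
by rewrite /f /g; apply/funext => h; rewrite !HE; congr (_ *: _); ring.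
Qed.

Lemma separable_partial_p H (x p : R) : separable H ->
  partial_p H x p = partial_p H 0 p.
Proof.
move=> [H1 [H2 HE]]; rewrite /partial_p /derive1;
  set f := (fun _ : R => _); set g := (fun _ : R => _).
suff -> : f = g by [].
by rewrite /f /g; apply/funext => h; rewrite !HE; congr (_ *: _); ring.
Qed.

Lemma partial_x_bounds H : separable H -> uniformly_concave_fst H ->
  lipschitz_partials H -> exists gamma K : R, [/\ 0 < gamma, 0 < K,
    forall x y p q : R, (partial_x H x p - partial_x H y q) * (x - y)
      <= - gamma * (x - y) ^+ 2 &
    forall x y p q : R, `|partial_x H x p - partial_x H y q| <= K * `|x - y|].
Proof.
move=> sepH [gamma g0 cH] [dx _ [M [Mreal HM]] _].
exists gamma, (Num.max M 0 + 1); split=> //.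
- by rewrite ltr_wpDl// le_max lexx orbT.
- move=> x y p q.
  rewrite (separable_partial_x x p)// (separable_partial_x y q)//.
  have dN z : derivable (fun x => - H x 0) z 1 by apply: derivableN; exact: dx.
  have dE z : derive1 (fun x => - H x 0) z = - partial_x H z 0.
    exact: derive1N.
  by have := uniformly_convex_monotone x y (cH 0) dN; rewrite !dE; lra.
- move=> x y p q.
  rewrite (separable_partial_x x p)// (separable_partial_x y q)//.
  have MK : M < Num.max M 0 + 1 by rewrite ltr_pwDr// le_max lexx.
  have := HM _ MK ((x, 0), (y, 0)) (conj I I).
  by rewrite /= prod_normE /= subrr normr0 (max_idPl (normr_ge0 _)).
Qed.

Lemma partial_p_bounds H : separable H -> uniformly_convex_snd H ->
  lipschitz_partials H -> exists gamma K : R, [/\ 0 < gamma, 0 < K,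
    forall x y p q : R, gamma * (p - q) ^+ 2
      <= (partial_p H x p - partial_p H y q) * (p - q) &
    forall x y p q : R, `|partial_p H x p - partial_p H y q| <= K * `|p - q|].
Proof.
move=> sepH [gamma g0 cH] [_ dp _ [M [Mreal HM]]].
exists gamma, (Num.max M 0 + 1); split=> //.
- by rewrite ltr_wpDl// le_max lexx orbT.
- move=> x y p q.
  rewrite (separable_partial_p x p)// (separable_partial_p y q)//.
  exact: uniformly_convex_monotone (cH 0) (dp 0).
- move=> x y p q.
  rewrite (separable_partial_p x p)// (separable_partial_p y q)//.
  have MK : M < Num.max M 0 + 1 by rewrite ltr_pwDr// le_max lexx.
  have := HM _ MK ((0, p), (0, q)) (conj I I).
  by rewrite /= prod_normE /= subrr normr0 (max_idPr (normr_ge0 _)).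
Qed.

End convexity.

(** * Dynamics of the difference of two solutions *)

Section progressive_processes.
Context {R : realType} {d : measure_display} {Omega : measurableType d}.
Variables (T : R) (F : R -> set (set Omega)).
Implicit Types f g : R -> Omega -> R.

Lemma lipschitz_measurable (f : R -> R) (K : R) : 0 < K ->
  (forall x y, `|f x - f y| <= K * `|x - y|) -> measurable_fun setT f.
Proof.
move=> K0 fK; apply: continuous_measurable_fun => x.
apply/cvgrPdist_le => /= e e0; near=> y.
rewrite (le_trans (fK x y))// -ler_pdivlMl// mulrC.
by near: y; apply: cvgr_dist_le; rewrite ?divr_gt0.
Unshelve. all: by end_near. Qed.

Lemma progressive_cst (c : R) : progressive T F (fun _ _ => c).
Proof. by move=> t t0T; exact: measurable_cst. Qed.

Lemma progressiveD f g : progressive T F f -> progressive T F g ->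
  progressive T F (fun t w => f t w + g t w).
Proof. by move=> pf pg t t0T; apply: measurable_funD; [exact: pf|exact: pg]. Qed.

Lemma progressiveB f g : progressive T F f -> progressive T F g ->
  progressive T F (fun t w => f t w - g t w).
Proof. by move=> pf pg t t0T; apply: measurable_funB; [exact: pf|exact: pg]. Qed.

Lemma progressive_comp (G : R -> R) f : measurable_fun setT G ->
  progressive T F f -> progressive T F (fun t w => G (f t w)).
Proof. by move=> mG pf t t0T; apply: (measurableT_comp mG); exact: pf. Qed.

Lemma time_cutB f g z :
  time_cut T (fun t w => f t w - g t w) z = time_cut T f z - time_cut T g z.
Proof. by rewrite /time_cut; case: ifP => // _; rewrite subr0. Qed.

End progressive_processes.

Section dynamics.
Context {R : realType} {d : measure_display} {Omega : measurableType d}.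
Variables (P : probability Omega R) (T : R) (F : R -> set (set Omega)).
Variables (W : R -> Omega -> R).
Hypothesis T_gt0 : 0 < T.
Hypotheses (filtF : complete_filtration P T F).
Local Notation lam := (time_measure T).
Local Notation nu := (P \x lam)%E.
Local Notation mu := (@lebesgue_measure R).
Local Notation cut := (time_cut T).

Let T0T : 0 <= T <= T. Proof. by rewrite lexx ltW. Qed.

Lemma cut_total (f : R -> Omega -> R) w :
  \int[lam]_s cut f (w, s) = \int[lam]_(s in `]-oo, T]) cut f (w, s).
Proof.
rewrite [RHS]Rintegral_mkcond; congr Rintegral; apply/funext => s.
rewrite /patch mem_setE/= in_itv/=; case: ifPn => // /negbTE sT.
by rewrite time_cut0// sT andbF.
Qed.

Lemma time_differentialB (x1 x2 b1 b2 : R -> Omega -> R) (x0 : R) :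
  time_differential P T x1 b1 -> time_differential P T x2 b2 ->
  {ae P, forall w, x1 0 w = x0} -> {ae P, forall w, x2 0 w = x0} ->
  {ae P, forall w,
    x1 T w - x2 T w = \int[lam]_s cut (fun t w => b1 t w - b2 t w) (w, s) /\
    forall t : R, 0 <= t <= T -> x1 t w - x2 t w =
      \int[lam]_(s in `]-oo, t]) cut (fun t w => b1 t w - b2 t w) (w, s)}.
Proof.
move=> [I1 E1] [I2 E2] i1 i2.
apply: filterS3 (filterI I1 E1) (filterI I2 E2) (filterI i1 i2).
move=> w [I1w E1w] [I2w E2w] [i1w i2w].
have E t : 0 <= t <= T -> x1 t w - x2 t w =
    \int[lam]_(s in `]-oo, t]) cut (fun t w => b1 t w - b2 t w) (w, s).
  move=> t0T; rewrite (time_Rintegral_prefix (fun s => b1 s w - b2 s w))//.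
  have sub : `[0, t]%classic `<=` `[0, T]%classic.
    move=> s /=; rewrite !in_itv/= => /andP[-> st].
    by case/andP: t0T => _; exact: le_trans.
  rewrite RintegralB//.
  - by rewrite E1w// E2w// i1w i2w; ring.
  - by apply: integrableS I1w => //; exact: measurable_itv.
  - by apply: integrableS I2w => //; exact: measurable_itv.
by split=> //; rewrite cut_total; exact: E.
Qed.

Lemma ito_differentialB (y1 y2 b1 b2 Z1 Z2 : R -> Omega -> R) :
  ito_differential P T F W y1 b1 Z1 -> ito_differential P T F W y2 b2 Z2 ->
  L2 nu (cut (fun t w => b1 t w - b2 t w)) ->
  exists M1 M2 : R -> Omega -> R,
  [/\ is_ito_integral P T F W Z1 M1, is_ito_integral P T F W Z2 M2 &
    {ae P, forall w, forall t : R, 0 <= t <= T ->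
      (y1 T w - y2 T w) - (y1 t w - y2 t w)
        - ((M1 T w - M1 t w) - (M2 T w - M2 t w)) =
      \int[lam]_(s in `]t, +oo[) cut (fun t w => b1 t w - b2 t w) (w, s)}].
Proof.
move=> [I1 [M1 ito1 E1]] [I2 [M2 ito2 E2]] Lb; exists M1, M2; split=> //.
apply: filterS3 (filterI I1 E1) (filterI I2 E2) (L2_sections1 Lb).
move=> w [I1w E1w] [I2w E2w] /L2_L1 Lbw t t0T.
have E s : 0 <= s <= T -> \int[mu]_(r in `[0, s]) b1 r w - \int[mu]_(r in `[0, s]) b2 r w =
    \int[lam]_(r in `]-oo, s]) cut (fun t w => b1 t w - b2 t w) (w, r).
  move=> s0T; rewrite (time_Rintegral_prefix (fun s => b1 s w - b2 s w))//.
  have sub : `[0, s]%classic `<=` `[0, T]%classic.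
    move=> r /=; rewrite !in_itv/= => /andP[-> rs].
    by case/andP: s0T => _; exact: le_trans.
  rewrite RintegralB//.
  - by apply: integrableS I1w => //; exact: measurable_itv.
  - by apply: integrableS I2w => //; exact: measurable_itv.
have := Rintegral_split t Lbw; rewrite cut_total -(E T)// -(E t)//.
by rewrite (E1w T)// (E1w t)// (E2w T)// (E2w t)//; lra.
Qed.

(** [M T w - M t w] looks into the future, so the process is not progressive and
joint measurability has to come from its two terms separately. *)
Lemma measurable_cut_increment (M : R -> Omega -> R) : progressive T F M ->
  measurable_fun setT (cut (fun t w => M T w - M t w)).
Proof.
move=> pM.
have -> : cut (fun t w => M T w - M t w) =
    (fun z => M T z.1 * cut (fun _ _ => 1) z - cut M z).
  apply/funext => z; rewrite /time_cut.
  by case: ifP => _; rewrite ?mulr1 ?mulr0 ?subr0.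
apply: measurable_funB; last exact: (measurable_time_cut T_gt0 filtF pM).
apply: measurable_funM.
  exact: (measurableT_comp (progressive_measurable filtF T0T pM) measurable_fst).
have := measurable_time_cut T_gt0 filtF (@progressive_cst R d Omega T F 1).
exact.
Qed.

End dynamics.

Lemma square_integrable_rv_L2 (R : realType) (d : measure_display)
    (Omega : measurableType d) (P : probability Omega R) (xi : Omega -> R) :
  square_integrable_rv P xi -> L2 P xi.
Proof.
move=> [mxi]; rewrite /rv_norm => fin; apply: L2P => //.
have I0 : (0 <= \int[P]_w ((xi w) ^+ 2)%:E)%E.
  by apply: integral_ge0 => w _; rewrite lee_fin sqr_ge0.
by rewrite -ge0_fin_numE// -sqrte_fin_num// ge0_fin_numE// sqrte_ge0.
Qed.

(** * Estimates for a single player *)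

Section player.
Context {R : realType} {d : measure_display} {Omega : measurableType d}.
Variables (P : probability Omega R) (T : R) (F : R -> set (set Omega)).
Variables (W : R -> Omega -> R).
Hypothesis T_gt0 : 0 < T.
Hypotheses (filtF : complete_filtration P T F).
Hypotheses (W_bm : is_brownian_motion P T F W).
Local Notation lam := (time_measure T).
Local Notation nu := (P \x lam)%E.
Local Notation cut := (time_cut T).

Variables (H : R -> R -> R) (uT : R -> R) (gx Kx gp Kp Ku : R).
Hypotheses (gx_gt0 : 0 < gx) (Kx_gt0 : 0 < Kx).
Hypotheses (Kp_gt0 : 0 < Kp) (Ku_gt0 : 0 < Ku).
Hypothesis H_separable : separable H.
Hypothesis Hx_monotone : forall x y p q : R,
  (partial_x H x p - partial_x H y q) * (x - y) <= - gx * (x - y) ^+ 2.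
Hypothesis Hx_lipschitz : forall x y p q : R,
  `|partial_x H x p - partial_x H y q| <= Kx * `|x - y|.
Hypothesis Hp_monotone : forall x y p q : R,
  gp * (p - q) ^+ 2 <= (partial_p H x p - partial_p H y q) * (p - q).
Hypothesis Hp_lipschitz : forall x y p q : R,
  `|partial_p H x p - partial_p H y q| <= Kp * `|p - q|.
Hypothesis uT_monotone : forall x y : R,
  0 <= (derive1 uT x - derive1 uT y) * (x - y).
Hypothesis uT_lipschitz : forall x y : R,
  `|derive1 uT x - derive1 uT y| <= Ku * `|x - y|.

Variables (X Y Z varpi X' Y' Z' varpi' eps : R -> Omega -> R).
Variables (epsT : Omega -> R) (x0 : R).
Local Notation sqi := (square_integrable_process P T F).
Hypotheses (sX : sqi X) (sY : sqi Y) (sX' : sqi X') (sY' : sqi Y').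
Hypotheses (sv : sqi varpi) (sv' : sqi varpi') (seps : sqi eps).
Hypotheses (sXT : square_integrable_rv P (X T)).
Hypotheses (sXT' : square_integrable_rv P (X' T)).
Hypotheses (sepsT : square_integrable_rv P epsT).

Let Hx t w := partial_x H (X t w) (Y t w + varpi t w).
Let Hx' t w := partial_x H (X' t w) (Y' t w + varpi' t w).
Let Hp t w := partial_p H (X t w) (Y t w + varpi t w).
Let Hp' t w := partial_p H (X' t w) (Y' t w + varpi' t w).

Hypothesis dY : ito_differential P T F W Y Hx Z.
Hypothesis dY' : ito_differential P T F W Y'
  (fun t w => Hx' t w + eps t w) Z'.
Hypothesis dX : time_differential P T X (fun t w => - Hp t w).
Hypothesis dX' : time_differential P T X' (fun t w => - Hp' t w).
Hypothesis X0 : {ae P, forall w, X 0 w = x0}.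
Hypothesis X0' : {ae P, forall w, X' 0 w = x0}.
Hypothesis YT : {ae P, forall w, Y T w = derive1 uT (X T w)}.
Hypothesis YT' : {ae P, forall w, Y' T w = derive1 uT (X' T w) - epsT w}.

Let x t w := X t w - X' t w.
Let y t w := Y t w - Y' t w.
Let v t w := varpi t w - varpi' t w.
Let p t w := (Y t w + varpi t w) - (Y' t w + varpi' t w).
Let a t w := - Hp t w - - Hp' t w.
Let b t w := Hx t w - (Hx' t w + eps t w).
Let yT w := derive1 uT (X T w) - derive1 uT (X' T w) + epsT w.

Let measurable_Hp0 : measurable_fun setT (partial_p H 0).
Proof. by apply: (lipschitz_measurable Kp_gt0) => p0 q0; exact: Hp_lipschitz. Qed.

Let measurable_Hx0 : measurable_fun setT (fun x1 => partial_x H x1 0).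
Proof. by apply: (lipschitz_measurable Kx_gt0) => p0 q0; exact: Hx_lipschitz. Qed.

Let measurable_duT : measurable_fun setT (derive1 uT).
Proof. by apply: (lipschitz_measurable Ku_gt0) => p0 q0; exact: uT_lipschitz. Qed.

Let Hp_progressive U V pi : sqi U -> sqi V -> sqi pi ->
  progressive T F (fun t w => - partial_p H (U t w) (V t w + pi t w)).
Proof.
move=> [pU _] [pV _] [pp _].
have -> : (fun t w => - partial_p H (U t w) (V t w + pi t w)) =
    (fun t w => 0 - partial_p H 0 (V t w + pi t w)).
  apply/funext => t; apply/funext => w.
  by rewrite sub0r (separable_partial_p (U t w))//.
apply: progressiveB; first exact: progressive_cst.
by apply: progressive_comp => //; exact: progressiveD.
Qed.

Let Hx_progressive U V pi : sqi U ->
  progressive T F (fun t w => partial_x H (U t w) (V t w + pi t w)).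
Proof.
move=> [pU _].
have -> : (fun t w => partial_x H (U t w) (V t w + pi t w)) =
    (fun t w => partial_x H (U t w) 0).
  by apply/funext => t; apply/funext => w; exact: separable_partial_x.
exact: (progressive_comp measurable_Hx0 pU).
Qed.

Let pa : progressive T F a.
Proof. by apply: progressiveB; exact: Hp_progressive. Qed.

Let pb : progressive T F b.
Proof.
apply: progressiveB; first exact: Hx_progressive.
by apply: progressiveD; [exact: Hx_progressive|case: seps].
Qed.

Let py : progressive T F y.
Proof. by apply: progressiveB; [case: sY|case: sY']. Qed.

Let Lx : L2 nu (cut x).
Proof.
have := L2B (L2_time_cut T_gt0 filtF sX) (L2_time_cut T_gt0 filtF sX').
by congr L2; apply/funext => z; rewrite time_cutB.
Qed.

Let Ly : L2 nu (cut y).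
Proof.
have := L2B (L2_time_cut T_gt0 filtF sY) (L2_time_cut T_gt0 filtF sY').
by congr L2; apply/funext => z; rewrite time_cutB.
Qed.

Lemma L2_price_gap : L2 nu (cut v).
Proof.
have := L2B (L2_time_cut T_gt0 filtF sv) (L2_time_cut T_gt0 filtF sv').
by congr L2; apply/funext => z; rewrite time_cutB.
Qed.
Let Lv := L2_price_gap.

Let Leps : L2 nu (cut eps).
Proof. exact: (L2_time_cut T_gt0 filtF). Qed.

Let pE z : cut p z = cut y z + cut v z.
Proof. by rewrite /p /time_cut; case: ifP => _; rewrite /y /v; ring. Qed.

Let Lp : L2 nu (cut p).
Proof. by have := L2D Ly Lv; congr L2; apply/funext => z; rewrite pE. Qed.

Let a_le z : `|cut a z| <= Kp * `|cut p z|.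
Proof.
rewrite /time_cut; case: ifP => _; last by rewrite normr0 mulr0.
have -> : a z.2 z.1 = - (Hp z.2 z.1 - Hp' z.2 z.1) by rewrite /a; ring.
by rewrite normrN; exact: Hp_lipschitz.
Qed.

Lemma L2_velocity_gap : L2 nu (cut a).
Proof.
have Lkp := L2Z Kp Lp; apply: L2_le Lkp.
  exact: (measurable_time_cut T_gt0 filtF pa).
by move=> z; rewrite normrM (gtr0_norm Kp_gt0); exact: a_le.
Qed.
Let La := L2_velocity_gap.

Let b_le z : cut b z ^+ 2 <= 2 * (Kx ^+ 2 * cut x z ^+ 2) + 2 * cut eps z ^+ 2.
Proof.
rewrite /time_cut; case: ifP => _; last by rewrite expr0n/= !mulr0 addr0.
set h := Hx z.2 z.1 - Hx' z.2 z.1.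
have hx : `|h| <= Kx * `|x z.2 z.1| by exact: Hx_lipschitz.
have : h ^+ 2 <= Kx ^+ 2 * x z.2 z.1 ^+ 2.
  rewrite -exprMn -(real_normK (num_real h)) -(real_normK (num_real (_ * _))).
  by rewrite lerXn2r ?nnegrE// normrM (gtr0_norm Kx_gt0).
have -> : b z.2 z.1 = h - eps z.2 z.1 by rewrite /b /h; ring.
by have := sqr_ge0 (h + eps z.2 z.1); lra.
Qed.

Let Lb : L2 nu (cut b).
Proof.
have mb := measurable_time_cut T_gt0 filtF pb.
split=> //; have [_ Ix2] := Lx; have [_ Ieps2] := Leps.
apply: (L1_le _ _ (L1D (L1Z 2 (L1Z (Kx ^+ 2) Ix2)) (L1Z 2 Ieps2))).
  exact: measurable_funX.
by move=> z; rewrite ger0_norm ?sqr_ge0//; exact: b_le.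
Qed.

Let LepsT : L2 P epsT := square_integrable_rv_L2 sepsT.

Let LxT : L2 P (x T).
Proof. by apply: L2B; exact: square_integrable_rv_L2. Qed.

Let yT_le w : yT w ^+ 2 <= 2 * (Ku ^+ 2 * x T w ^+ 2) + 2 * epsT w ^+ 2.
Proof.
set h := derive1 uT (X T w) - derive1 uT (X' T w).
have hx : `|h| <= Ku * `|x T w| by exact: uT_lipschitz.
have : h ^+ 2 <= Ku ^+ 2 * x T w ^+ 2.
  rewrite -exprMn -(real_normK (num_real h)) -(real_normK (num_real (_ * _))).
  by rewrite lerXn2r ?nnegrE// normrM (gtr0_norm Ku_gt0).
have -> : yT w = h + epsT w by [].
by have := sqr_ge0 (h - epsT w); lra.
Qed.

Let LyT : L2 P yT.
Proof.
have [mXT _] := sXT; have [mXT' _] := sXT'; have [mepsT _] := sepsT.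
have myT : measurable_fun setT yT.
  apply: measurable_funD => //; apply: measurable_funB;
    exact: measurableT_comp.
split=> //; have [_ Ix2] := LxT; have [_ Ieps2] := LepsT.
apply: (L1_le _ _ (L1D (L1Z 2 (L1Z (Ku ^+ 2) Ix2)) (L1Z 2 Ieps2))).
  exact: measurable_funX.
by move=> w; rewrite ger0_norm ?sqr_ge0//; exact: yT_le.
Qed.

Let pairing : [/\ \int[P]_w (x T w * yT w) =
    \int[nu]_z (cut a z * cut y z) + \int[nu]_z (cut b z * cut x z),
  \int[P]_w x T w ^+ 2 <= T * \int[nu]_z cut a z ^+ 2 &
  \int[nu]_z cut y z ^+ 2 <=
    T * (2 * \int[P]_w yT w ^+ 2 + 2 * (T * \int[nu]_z cut b z ^+ 2))].
Proof.
have xE := time_differentialB T_gt0 dX dX' X0 X0'.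
have [M [M' [ito ito' yE0]]] := ito_differentialB T_gt0 dY dY' Lb.
pose dm t w := (M T w - M t w) - (M' T w - M' t w).
have yE : {ae P, forall w, forall t : R, 0 <= t <= T ->
    yT w - y t w - dm t w = \int[lam]_(s in `]t, +oo[) cut b (w, s)}.
  apply: filterS3 yE0 YT YT' => w yEw YTw YTw' t t0T.
  by rewrite -yEw// YTw YTw' /yT /y /dm; ring.
have mdm : measurable_fun setT (cut dm).
  have [pM _ _] := ito; have [pM' _ _] := ito'.
  have := measurable_funB (measurable_cut_increment T_gt0 filtF pM)
    (measurable_cut_increment T_gt0 filtF pM').
  by congr measurable_fun; apply/funext => z; rewrite /dm time_cutB.
have Ldm : L2 nu (cut dm) := martingale_increment_L2 T_gt0 Lb Ly mdm LyT yE.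
have ort f : progressive T F f -> L2 nu (cut f) ->
    \int[nu]_z (cut f z * cut dm z) = 0.
  move=> pf Lf; apply: (ito_increment_orthogonal filtF W_bm ito ito') => //.
  by move=> t t0T; exact: (progressive_measurable_at t0T pf).
have mxT : measurable_fun setT (x T) by case: LxT.
split.
- exact: (terminal_pairing T_gt0 La Lb Lx Ly mdm mxT LyT xE yE (ort _ pa La)).
- by have [] := terminal_state_L2 T_gt0 La mxT xE.
- exact: (adjoint_L2_le T_gt0 Lb Ly mdm LyT yE (ort _ py Ly)).
Qed.

Let aa_le : \int[nu]_z cut a z ^+ 2 <= Kp ^+ 2 * \int[nu]_z cut p z ^+ 2.
Proof.
have [_ Ia] := La; have [_ Ip] := Lp.
rewrite -RintegralZl//; apply: le_Rintegral => //; first exact: L1Z.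
move=> z _; rewrite -exprMn -(real_normK (num_real (cut a z))).
rewrite -(real_normK (num_real (_ * _))).
by rewrite lerXn2r ?nnegrE// normrM (gtr0_norm Kp_gt0).
Qed.

(** In [E (x T * y T) = E (int a * y) + E (int b * x)] the left-hand side is
bounded below by the monotonicity of [uT'], the right-hand side above by those of
the partial derivatives of [H]; [theta] is the weight of the Young inequality
that splits [x T * epsT]. *)
Lemma player_monotonicity (theta : R) : 0 < theta ->
  gp * \int[nu]_z cut p z ^+ 2 + gx / 2 * \int[nu]_z cut x z ^+ 2 <=
  theta * (T * (Kp ^+ 2 * \int[nu]_z cut p z ^+ 2))
  + (4 * theta)^-1 * \int[P]_w epsT w ^+ 2
  + (2 * gx)^-1 * \int[nu]_z cut eps z ^+ 2
  - \int[nu]_z (cut a z * cut v z).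
Proof.
move=> theta0; have [pair xT_le _] := pairing.
have [_ Ip2] := Lp; have [_ Ix2] := Lx; have [_ Ieps2] := Leps.
have [_ IxT2] := LxT; have [_ IepsT2] := LepsT.
have lower : - theta * \int[P]_w x T w ^+ 2 - (4 * theta)^-1 * \int[P]_w epsT w ^+ 2
    <= \int[P]_w (x T w * yT w).
  rewrite -!RintegralZl// -RintegralB//; [|exact: L1Z|exact: L1Z].
  apply: le_Rintegral => //; first by apply: L1B; exact: L1Z.
    exact: L2M.
  move=> w _; have := uT_monotone (X T w) (X' T w).
  rewrite /yT -/(x T w); set h := derive1 uT _ - derive1 uT _ => hx.
  have : 0 <= theta * (x T w + (2 * theta)^-1 * epsT w) ^+ 2.
    by rewrite mulr_ge0 ?sqr_ge0// ltW.
  have -> : theta * (x T w + (2 * theta)^-1 * epsT w) ^+ 2 =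
      theta * x T w ^+ 2 + x T w * epsT w + (4 * theta)^-1 * epsT w ^+ 2.
    by field; rewrite gt_eqF.
  by lra.
have Iav := L2M La Lv; have Iay := L2M La Ly; have Ibx := L2M Lb Lx.
have upper1 : \int[nu]_z (cut a z * cut y z) <=
    - gp * \int[nu]_z cut p z ^+ 2 - \int[nu]_z (cut a z * cut v z).
  rewrite -RintegralZl// -RintegralB//; last exact: L1Z.
  apply: le_Rintegral => //; first by apply: L1B => //; exact: L1Z.
  move=> z _; have : cut a z * cut p z <= - gp * cut p z ^+ 2.
    rewrite /time_cut; case: ifP => _; last by rewrite mul0r expr0n mulr0.
    have -> : a z.2 z.1 = - (Hp z.2 z.1 - Hp' z.2 z.1) by rewrite /a; ring.
    by rewrite !mulNr lerN2; exact: Hp_monotone.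
  by rewrite pE; lra.
have upper2 : \int[nu]_z (cut b z * cut x z) <=
    - (gx / 2) * \int[nu]_z cut x z ^+ 2 + (2 * gx)^-1 * \int[nu]_z cut eps z ^+ 2.
  rewrite -!RintegralZl// -RintegralD//; [|exact: L1Z|exact: L1Z].
  apply: le_Rintegral => //; first by apply: L1D => //; exact: L1Z.
  move=> z _; rewrite /time_cut; case: ifP => _; last first.
    by rewrite mul0r expr0n/= !mulr0 addr0.
  set h := Hx z.2 z.1 - Hx' z.2 z.1.
  have : h * x z.2 z.1 <= - gx * x z.2 z.1 ^+ 2 by exact: Hx_monotone.
  have -> : b z.2 z.1 = h - eps z.2 z.1 by rewrite /b /h; ring.
  set xx := x _ _; set ee := eps _ _ => hx.
  have : 0 <= gx / 2 * (xx + gx^-1 * ee) ^+ 2.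
    by rewrite mulr_ge0 ?sqr_ge0// divr_ge0// ltW.
  have -> : gx / 2 * (xx + gx^-1 * ee) ^+ 2 =
      gx / 2 * xx ^+ 2 + xx * ee + (2 * gx)^-1 * ee ^+ 2.
    by field; rewrite gt_eqF.
  by lra.
have xT_bound : theta * \int[P]_w x T w ^+ 2 <=
    theta * (T * (Kp ^+ 2 * \int[nu]_z cut p z ^+ 2)).
  by rewrite ler_pM2l// (le_trans xT_le)// ler_pM2l.
by lra.
Qed.

(** [v = p - y], the bound on [y] by its terminal value and drift, and the
Lipschitz bounds on these. *)
Lemma price_gap_le : \int[nu]_z cut v z ^+ 2 <=
  2 * \int[nu]_z cut p z ^+ 2 + 2 * (T * (2 *
   (2 * (Ku ^+ 2 * (T * (Kp ^+ 2 * \int[nu]_z cut p z ^+ 2)))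
     + 2 * \int[P]_w epsT w ^+ 2)
   + 2 * (T * (2 * (Kx ^+ 2 * \int[nu]_z cut x z ^+ 2)
     + 2 * \int[nu]_z cut eps z ^+ 2)))).
Proof.
have [_ xT_le y_le] := pairing.
have [_ Ip2] := Lp; have [_ Ix2] := Lx; have [_ Ieps2] := Leps.
have [_ IxT2] := LxT; have [_ IepsT2] := LepsT; have [_ IyT2] := LyT.
have [_ Iv2] := Lv; have [_ Iy2] := Ly; have [_ Ib2] := Lb.
have v_le : \int[nu]_z cut v z ^+ 2 <=
    2 * \int[nu]_z cut p z ^+ 2 + 2 * \int[nu]_z cut y z ^+ 2.
  rewrite -!RintegralZl// -RintegralD//; [|exact: L1Z|exact: L1Z].
  apply: le_Rintegral => //; first by apply: L1D => //; exact: L1Z.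
  by move=> z _; rewrite pE; have := sqr_ge0 (2 * cut y z + cut v z); lra.
have bb_le : \int[nu]_z cut b z ^+ 2 <=
    2 * (Kx ^+ 2 * \int[nu]_z cut x z ^+ 2) + 2 * \int[nu]_z cut eps z ^+ 2.
  rewrite -!RintegralZl//; last exact: L1Z.
  rewrite -RintegralD//; [|by do 2 apply: L1Z|exact: L1Z].
  apply: le_Rintegral => //; first by apply: L1D; [do 2 apply: L1Z|exact: L1Z].
have yT_bound : \int[P]_w yT w ^+ 2 <=
    2 * (Ku ^+ 2 * \int[P]_w x T w ^+ 2) + 2 * \int[P]_w epsT w ^+ 2.
  rewrite -!RintegralZl//; last exact: L1Z.
  rewrite -RintegralD//; [|by do 2 apply: L1Z|exact: L1Z].
  apply: le_Rintegral => //; first by apply: L1D; [do 2 apply: L1Z|exact: L1Z].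
have xT_bound : Ku ^+ 2 * \int[P]_w x T w ^+ 2 <=
    Ku ^+ 2 * (T * (Kp ^+ 2 * \int[nu]_z cut p z ^+ 2)).
  by rewrite ler_pM2l ?exprn_gt0// (le_trans xT_le)// ler_pM2l.
have Tbb_le := bb_le; rewrite -(ler_pM2l T_gt0) in Tbb_le.
apply: (le_trans v_le); rewrite lerD2l ler_pM2l//.
apply: (le_trans y_le); rewrite ler_pM2l//.
by apply: lerD; rewrite ler_pM2l//; lra.
Qed.

End player.

(** * Market clearing and the final estimate *)

Section market.
Context {R : realType} {d : measure_display} {Omega : measurableType d}.
Variables (P : probability Omega R) (T : R) (N : nat).
Local Notation lam := (time_measure T).
Local Notation nu := (P \x lam)%E.
Local Notation cut := (time_cut T).

(** Market clearing holds almost surely at each time, with an exceptional set that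
depends on the time; pairing it with [v] therefore integrates over the sample
point first. *)
Lemma market_clearing_pairing (a : 'I_N -> R -> Omega -> R)
    (v e : R -> Omega -> R) :
  (forall n, L2 nu (cut (a n))) -> L2 nu (cut v) -> L2 nu (cut e) ->
  (forall t : R, 0 <= t <= T ->
    {ae P, forall w, \sum_(n < N) a n t w = - (N%:R * e t w)}) ->
  \sum_(n < N) \int[nu]_z (cut (a n) z * cut v z) =
  - (N%:R * \int[nu]_z (cut e z * cut v z)).
Proof.
move=> La Lv Le clear.
have Iav n := L2M (La n) Lv; have Iev := L2M Le Lv.
rewrite -Rintegral_sum// -mulNr -RintegralZl//.
have Isum : L1 nu (fun z => \sum_(n < N) cut (a n) z * cut v z) by exact: L1_sum.
have IZ := L1Z (- N%:R) Iev.
have [_ <-] := L1_iterated2 Isum; have [_ <-] := L1_iterated2 IZ.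
have ms := L1_measurable Isum; have mZ := L1_measurable IZ.
apply: eq_Rintegral => t _.
have [t0T|nt] := boolP (0 <= t <= T); last first.
  apply: eq_Rintegral => w _; rewrite [cut v _]time_cut0// !mulr0.
  by rewrite big1// => n _; rewrite mulr0.
apply: ae_eq_Rintegral.
- exact: (measurableT_comp ms (pair2_measurable t)).
- exact: (measurableT_comp mZ (pair2_measurable t)).
apply: filterS (clear t t0T) => w clear_w.
rewrite -mulr_suml time_cutE// (time_cutE e)//.
under eq_bigr do rewrite time_cutE//.
by rewrite clear_w; ring.
Qed.

End market.

Section absorption.
Context {R : realType}.

(** The weight [dl] is chosen so that, after [w <= k * (A + E)] is inserted, the
term [nn * dl * w] uses up exactly half of [g * A]. *)
Lemma absorb (g c k nn A E B w s : R) : 0 < g -> 0 <= c -> 0 < k -> 0 < nn ->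
  0 <= A -> 0 <= E -> 0 <= B ->
  g * A <= c * E + nn * s -> w <= k * (A + E) ->
  (forall dl : R, 0 < dl -> s <= dl * w + (4 * dl)^-1 * B) ->
  w <= k * (2 * c / g + 2 + nn ^+ 2 * k / g ^+ 2) * (E + B).
Proof.
move=> g0 c0 k0 nn0 A0 E0 B0 gA wA sw.
pose dl := g / (2 * nn * k).
have dl0 : 0 < dl by rewrite divr_gt0// !mulr_gt0.
have s_le : nn * s <= g / 2 * (A + E) + nn ^+ 2 * k / (2 * g) * B.
  have -> : g / 2 * (A + E) = nn * (dl * (k * (A + E))).
    by rewrite /dl; field; rewrite !gt_eqF.
  have -> : nn ^+ 2 * k / (2 * g) * B = nn * ((4 * dl)^-1 * B).
    by rewrite /dl; field; rewrite !gt_eqF.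
  rewrite -mulrDr ler_pM2l// (le_trans (sw _ dl0))// lerD2r.
  by rewrite ler_pM2l.
have A_le : A <= (2 * c / g + 1) * E + nn ^+ 2 * k / g ^+ 2 * B.
  rewrite -(ler_pM2l g0).
  have -> : g * ((2 * c / g + 1) * E + nn ^+ 2 * k / g ^+ 2 * B) =
     2 * (c * E + g / 2 * E + nn ^+ 2 * k / (2 * g) * B).
    by field; rewrite !gt_eqF.
  by lra.
apply: (le_trans wA); rewrite -mulrA ler_pM2l//.
have q0 : 0 <= nn ^+ 2 * k / g ^+ 2.
  by rewrite divr_ge0 ?sqr_ge0// mulr_ge0 ?sqr_ge0// ltW.
have r0 : 0 <= 2 * c / g by rewrite divr_ge0 ?mulr_ge0// ltW.
have := mulr_ge0 q0 E0; have := mulr_ge0 r0 B0; lra.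
Qed.

Lemma price_gap_coefficient (T Ku Kp Kx : R) : 0 < T ->
  exists k : R, 0 < k /\ forall p x t e : R,
  0 <= p -> 0 <= x -> 0 <= t -> 0 <= e ->
  2 * p + 2 * (T * (2 * (2 * (Ku ^+ 2 * (T * (Kp ^+ 2 * p))) + 2 * t)
   + 2 * (T * (2 * (Kx ^+ 2 * x) + 2 * e)))) <= k * (p + x + (t + e)).
Proof.
move=> T0; have Kp2 := sqr_ge0 Kp; have Ku2 := sqr_ge0 Ku; have Kx2 := sqr_ge0 Kx.
exists (2 + 2 * (T * (2 * (2 * (Ku ^+ 2 * (T * Kp ^+ 2)) + 2)
   + 2 * (T * (2 * Kx ^+ 2 + 2))))); split.
  have q1 : 0 <= Ku ^+ 2 * (T * Kp ^+ 2) by do 2 (apply: mulr_ge0 => //); exact: ltW.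
  have q2 : 0 <= T * (2 * Kx ^+ 2 + 2).
    by apply: mulr_ge0; [exact: ltW|lra].
  have : 0 <= T * (2 * (2 * (Ku ^+ 2 * (T * Kp ^+ 2)) + 2)
      + 2 * (T * (2 * Kx ^+ 2 + 2))) by apply: mulr_ge0; [exact: ltW|lra].
  by lra.
move=> p x t e p0 x0 t0 e0; set S := p + x + (t + e).
have [pS xS tS eS] : [/\ p <= S, x <= S, t <= S & e <= S] by rewrite /S; split; lra.
clearbody S.
have inner1 : Ku ^+ 2 * (T * (Kp ^+ 2 * p)) <= Ku ^+ 2 * (T * (Kp ^+ 2 * S)).
  by apply: ler_wpM2l => //; apply: ler_wpM2l; [exact: ltW|exact: ler_wpM2l].
have inner2 : T * (2 * (Kx ^+ 2 * x) + 2 * e) <= T * (2 * (Kx ^+ 2 * S) + 2 * S).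
  have Kxx : Kx ^+ 2 * x <= Kx ^+ 2 * S by exact: ler_wpM2l.
  by rewrite ler_pM2l//; lra.
have : T * (2 * (2 * (Ku ^+ 2 * (T * (Kp ^+ 2 * p))) + 2 * t)
   + 2 * (T * (2 * (Kx ^+ 2 * x) + 2 * e))) <=
   T * (2 * (2 * (Ku ^+ 2 * (T * (Kp ^+ 2 * S))) + 2 * S)
   + 2 * (T * (2 * (Kx ^+ 2 * S) + 2 * S))).
  by rewrite ler_pM2l//; lra.
by lra.
Qed.

End absorption.

Theorem theorem1 (R : realType) (T : R) (N : nat)
  (H L : R -> R -> R) (uT : R -> R) (x0 : 'I_N -> R)
  (q0 : R) (bS sigmaS : R -> R -> R)
  (T_gt0 : 0 < T) (N_ge1 : (1 <= N)%N)
  (L_convex : uniformly_convex_snd L)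
  (H_legendre : is_legendre_transform H L)
  (H_concave_x : uniformly_concave_fst H)
  (H_convex_p : uniformly_convex_snd H)
  (H_separable : separable H)
  (H_lipschitz : lipschitz_partials H)
  (uT_convex : convex_function [set: R^o] (uT : R^o -> R^o))
  (uT_lipschitz : lipschitz_derivative uT)
  (supply_lipschitz : sde_coefficients T bS sigmaS) :
  exists2 C : R, 0 < C &
    forall (d : measure_display) (Omega : measurableType d)
      (P : probability Omega R) (F : R -> set (set Omega))
      (W Q : R -> Omega -> R)
      (X Y : 'I_N -> R -> Omega -> R) (varpi : R -> Omega -> R)
      (eps : 'I_N -> R -> Omega -> R) (epsT : 'I_N -> Omega -> R)
      (epsB : R -> Omega -> R)
      (X' Y' : 'I_N -> R -> Omega -> R) (varpi' : R -> Omega -> R),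
    complete_filtration P T F ->
    is_brownian_motion P T F W ->
    solves_supply_sde P T F W q0 bS sigmaS Q ->
    solves_price_formation P T F W H uT x0 Q X Y varpi ->
    approx_solves_price_formation P T F W H uT x0 Q eps epsT epsB
      X' Y' varpi' ->
    (process_norm P T (fun t w => varpi t w - varpi' t w)%R
     <= C%:E * (error_norm P T eps epsT + process_norm P T epsB))%E.
Proof.
have [gx [Kx [gx0 Kx0 Hx_mono Hx_lip]]] :=
  partial_x_bounds H_separable H_concave_x H_lipschitz.
have [gp [Kp [gp0 Kp0 Hp_mono Hp_lip]]] :=
  partial_p_bounds H_separable H_convex_p H_lipschitz.
have [duT lip_duT] := uT_lipschitz; have [Ku Ku0 uT_lip] := lipschitz_bound lip_duT.
have uT_mono x y : 0 <= (derive1 uT x - derive1 uT y) * (x - y).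
  have := uniformly_convex_monotone x y (convex_uniformly_convex0 uT_convex) duT.
  by rewrite mul0r.
(* [theta] makes the contribution of [x T] equal to half of [gp * |p|^2]. *)
pose theta := gp / (2 * (T * Kp ^+ 2)).
have theta0 : 0 < theta by rewrite divr_gt0// !mulr_gt0// exprn_gt0.
have [g [g0 g_gp g_gx]] : exists g : R, [/\ 0 < g, g <= gp / 2 & g <= gx / 2].
  exists (Num.min gp gx / 2); split; first by rewrite divr_gt0// lt_min gp0.
    by rewrite ler_pM2r// ge_min lexx.
  by rewrite ler_pM2r// ge_min lexx orbT.
have th0 : 0 <= (4 * theta)^-1 by rewrite invr_ge0 mulr_ge0// ltW.
have gi0 : 0 <= (2 * gx)^-1 by rewrite invr_ge0 mulr_ge0// ltW.
have [c [c0 c_th c_gi]] : exists c : R,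
    [/\ 0 <= c, (4 * theta)^-1 <= c & (2 * gx)^-1 <= c].
  by exists ((4 * theta)^-1 + (2 * gx)^-1); split; lra.
have [k [k0 coef]] := price_gap_coefficient Ku Kp Kx T_gt0.
have nn0 : 0 < N%:R :> R by rewrite ltr0n.
pose C2 := k * (2 * c / g + 2 + N%:R ^+ 2 * k / g ^+ 2).
have C20 : 0 < C2.
  have cg0 : 0 <= 2 * c / g by rewrite divr_ge0 ?mulr_ge0// ltW.
  have Nq0 : 0 <= N%:R ^+ 2 * k / g ^+ 2.
    by rewrite divr_ge0 ?sqr_ge0// mulr_ge0 ?sqr_ge0// ltW.
  by rewrite /C2 mulr_gt0//; lra.
exists (Num.sqrt C2); first by rewrite sqrtr_gt0.
move=> d Omega P F W Q X Y varpi eps epsT epsB X' Y' varpi' filtF W_bm _.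
move=> [sv [Z [sXYZ [dXY clear]]]].
move=> [sv' [sB [seps [Z' [sXYZ' [dXY' clear']]]]]].
pose nu := (P \x time_measure T)%E.
pose v t w := varpi t w - varpi' t w.
pose p n t w := (Y n t w + varpi t w) - (Y' n t w + varpi' t w).
pose x n t w := X n t w - X' n t w.
pose a n t w := - partial_p H (X n t w) (Y n t w + varpi t w)
  - - partial_p H (X' n t w) (Y' n t w + varpi' t w).
pose pp n := \int[nu]_z time_cut T (p n) z ^+ 2.
pose xx n := \int[nu]_z time_cut T (x n) z ^+ 2.
pose ee n := \int[nu]_z time_cut T (eps n) z ^+ 2.
pose tt n := \int[P]_w epsT n w ^+ 2.
pose vv := \int[nu]_z time_cut T v z ^+ 2.
pose av n := \int[nu]_z (time_cut T (a n) z * time_cut T v z).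
have Lv : L2 nu (time_cut T v) := L2_price_gap T_gt0 filtF sv sv'.
have LB : L2 nu (time_cut T epsB) := L2_time_cut T_gt0 filtF sB.
have La n : L2 nu (time_cut T (a n)).
  have [sX sY sZ sXT] := sXYZ n; have [sX' sY' sZ' sXT'] := sXYZ' n.
  exact: (L2_velocity_gap T_gt0 filtF Kp0 H_separable Hp_lip sX sY sX' sY' sv sv').
have mono n : g * (pp n + xx n) <= c * (tt n + ee n) - av n.
  have [sX sY sZ sXT] := sXYZ n; have [sX' sY' sZ' sXT'] := sXYZ' n.
  have [dYn YTn dXn X0n] := dXY n; have [dYn' YTn' dXn' X0n'] := dXY' n.
  have [sepsn sepsTn] := seps n.
  have := player_monotonicity T_gt0 filtF W_bm gx0 Kx0 Kp0 Ku0 H_separable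
    Hx_mono Hx_lip Hp_mono Hp_lip uT_mono uT_lip sX sY sX' sY' sv sv' sepsn
    sXT sXT' sepsTn dYn dYn' dXn dXn' X0n X0n' YTn YTn' theta0.
  rewrite -/(p n) -/(x n) -/(a n) -/v -/nu -/(pp n) -/(xx n) -/(ee n) -/(tt n) -/(av n).
  have -> : theta * (T * (Kp ^+ 2 * pp n)) = gp / 2 * pp n.
    by rewrite /theta; field; rewrite !gt_eqF.
  have pp0 : 0 <= pp n by apply: Rintegral_ge0 => z _; exact: sqr_ge0.
  have xx0 : 0 <= xx n by apply: Rintegral_ge0 => z _; exact: sqr_ge0.
  have ee0 : 0 <= ee n by apply: Rintegral_ge0 => z _; exact: sqr_ge0.
  have tt0 : 0 <= tt n by apply: Rintegral_ge0 => z _; exact: sqr_ge0.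
  have gpp : g * pp n <= gp / 2 * pp n by rewrite ler_wpM2r.
  have gxx : g * xx n <= gx / 2 * xx n by rewrite ler_wpM2r.
  have ctt : (4 * theta)^-1 * tt n <= c * tt n by rewrite ler_wpM2r.
  have cee : (2 * gx)^-1 * ee n <= c * ee n by rewrite ler_wpM2r.
  by lra.
have gap n : vv <= k * (pp n + xx n + (tt n + ee n)).
  have [sX sY sZ sXT] := sXYZ n; have [sX' sY' sZ' sXT'] := sXYZ' n.
  have [dYn YTn dXn X0n] := dXY n; have [dYn' YTn' dXn' X0n'] := dXY' n.
  have [sepsn sepsTn] := seps n.
  apply: le_trans (coef _ _ _ _ _ _ _ _); last 4 first.
  - by apply: Rintegral_ge0 => z _; exact: sqr_ge0.
  - by apply: Rintegral_ge0 => z _; exact: sqr_ge0.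
  - by apply: Rintegral_ge0 => z _; exact: sqr_ge0.
  - by apply: Rintegral_ge0 => z _; exact: sqr_ge0.
  exact: (price_gap_le T_gt0 filtF W_bm Kx0 Kp0 Ku0 H_separable
    Hx_lip Hp_lip uT_lip sX sY sX' sY' sv sv' sepsn
    sXT sXT' sepsTn dYn dYn' dXn dXn' X0n X0n' YTn YTn').
have sum_av : \sum_(n < N) av n =
    - (N%:R * \int[nu]_z (time_cut T epsB z * time_cut T v z)).
  apply: market_clearing_pairing => // t t0T.
  apply: filterS2 (clear t t0T) (clear' t t0T) => w cl cl'.
  rewrite /a sumrB.
  have NK r : r = N%:R * (N%:R^-1 * r) :> R by rewrite mulVKf// gt_eqF.
  rewrite [X in X - _]NK [X in _ - X]NK.
  by rewrite cl cl'; ring.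
pose BB := \int[nu]_z time_cut T epsB z ^+ 2.
pose A := \sum_(n < N) (pp n + xx n).
pose E := \sum_(n < N) (tt n + ee n).
have pp0 n : 0 <= pp n by apply: Rintegral_ge0 => z _; exact: sqr_ge0.
have xx0 n : 0 <= xx n by apply: Rintegral_ge0 => z _; exact: sqr_ge0.
have ee0 n : 0 <= ee n by apply: Rintegral_ge0 => z _; exact: sqr_ge0.
have tt0 n : 0 <= tt n by apply: Rintegral_ge0 => z _; exact: sqr_ge0.
have BB0 : 0 <= BB by apply: Rintegral_ge0 => z _; exact: sqr_ge0.
have vv0 : 0 <= vv by apply: Rintegral_ge0 => z _; exact: sqr_ge0.
have A0 : 0 <= A by apply: sumr_ge0 => n _; exact: addr_ge0.
have E0 : 0 <= E by apply: sumr_ge0 => n _; exact: addr_ge0.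
have vv_le : vv <= C2 * (E + BB).
  apply: (absorb g0 c0 k0 nn0 A0 E0 BB0
    (s := \int[nu]_z (time_cut T epsB z * time_cut T v z))).
  - have -> : N%:R * \int[nu]_z (time_cut T epsB z * time_cut T v z) =
        - \sum_(n < N) av n by rewrite sum_av opprK.
    rewrite /A /E !mulr_sumr -sumrB; apply: ler_sum => n _; exact: mono.
  - pose n0 := Ordinal N_ge1; apply: le_trans (gap n0) _.
    rewrite ler_pM2l// /A /E (bigD1 n0)//= (bigD1 n0 (F := fun n => tt n + ee n))//=.
    have : 0 <= \sum_(i < N | i != n0) (pp i + xx i).
      by apply: sumr_ge0 => n _; exact: addr_ge0.
    have : 0 <= \sum_(i < N | i != n0) (tt i + ee i).
      by apply: sumr_ge0 => n _; exact: addr_ge0.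
    lra.
  - move=> dl dl0; have [_ Iv2] := Lv; have [_ IB2] := LB.
    rewrite /vv /BB -!RintegralZl// -RintegralD//; [|exact: L1Z|exact: L1Z].
    apply: le_Rintegral => //; [exact: L2M|by apply: L1D; exact: L1Z|move=> z _].
    have : 0 <= dl * (time_cut T v z - (2 * dl)^-1 * time_cut T epsB z) ^+ 2.
      by rewrite mulr_ge0 ?sqr_ge0// ltW.
    have -> : dl * (time_cut T v z - (2 * dl)^-1 * time_cut T epsB z) ^+ 2 =
        dl * time_cut T v z ^+ 2 + (4 * dl)^-1 * time_cut T epsB z ^+ 2
        - time_cut T epsB z * time_cut T v z.
      by field; rewrite gt_eqF.
    lra.
have pv : progressive T F v by apply: progressiveB; [case: sv|case: sv'].
have pB : progressive T F epsB by case: sB.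
have error_normE : error_norm P T eps epsT = (Num.sqrt E)%:E.
  rewrite /error_norm (eq_bigr (fun n => (tt n + ee n)%:E)); first by rewrite sumEFin.
  move=> n _; have [sepsn sepsTn] := seps n.
  have [pepsn _] := sepsn.
  rewrite (process_normE T_gt0 filtF pepsn (L2_time_cut T_gt0 filtF sepsn)).
  rewrite -[X in (X ^+ 2 + _)%E]/((Num.sqrt (ee n))%:E) -EFin_expe sqr_sqrtr//.
  rewrite /rv_norm sqr_sqrte; last by apply: integral_ge0 => w _; rewrite lee_fin sqr_ge0.
  by rewrite (L2_sqrE (square_integrable_rv_L2 sepsTn)) -EFinD addrC.
rewrite (process_normE T_gt0 filtF pv Lv) error_normE.
rewrite (process_normE T_gt0 filtF pB LB) -/nu -/vv -/BB -EFinD -EFinM lee_fin.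
apply: (@le_trans _ _ (Num.sqrt (C2 * (E + BB)))).
  by rewrite ler_wsqrtr.
rewrite sqrtrM ?(ltW C20)// ler_wpM2l ?sqrtr_ge0//.
rewrite -(ler_pXn2r (n := 2))// ?nnegrE ?addr_ge0 ?sqrtr_ge0//.
rewrite sqr_sqrtr ?addr_ge0// sqrrD !sqr_sqrtr//.
by rewrite addrAC lerDl mulrn_wge0// mulr_ge0 ?sqrtr_ge0.
Qed.
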